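(* Let $a,b,c,d,e\in\mathbb{R}$ with $b\neq 0$ and let $\mu\geq -1/2$. Let $f\in L^1_\mu(\mathbb{R})$ be such that $\mathcal{D}^{a,b,c}_{d,e,\mu}[f]\in L^1_\mu(\mathbb{R})$. Then the quadratic-phase Dunkl transform is inverted by the transform with parameters $(-c,-b,-a,-e,-d)$: for almost every $v\in\mathbb{R}$, $$f(v)=\mathcal{D}^{-c,-b,-a}_{-e,-d,\mu}\left[\mathcal{D}^{a,b,c}_{d,e,\mu}[f]\right](v)=\frac{c_\mu}{(-ib)^{\mu+1}}\int_{\mathbb{R}}\Psi^{-c,-b,-a}_{-e,-d,\mu}(v,w)\,\mathcal{D}^{a,b,c}_{d,e,\mu}[f](w)\,|w|^{2\mu+1}\,dw.$$
   Context: For $\mu\ge -1/2$, $L^1_\mu(\mathbb{R})$ is the space of measurable $f:\mathbb{R}\to\mathbb{C}$ (modulo a.e. equality) with $\int_{\mathbb{R}}|f(v)||v|^{2\mu+1}dv<\infty$. Put $c_\mu=\frac{1}{2^{\mu+1}\Gamma(\mu+1)}$. The normalized spherical Bessel function is $j_\mu(z)=\Gamma(\mu+1)\sum_{n=0}^{\infty}\frac{(-1)^n (z/2)^{2n}}{n!\,\Gamma(n+\mu+1)}$, and the Dunkl kernel is $E_\mu(iw,v)=j_\mu(wv)+\frac{iwv}{2(\mu+1)}\,j_{\mu+1}(wv)$ for $w,v\in\mathbb{R}$. For any real $a,b,c,d,e$ with $b\neq0$, the quadratic-phase Dunkl kernel is $\Psi^{a,b,c}_{d,e,\mu}(w,v)=e^{-i(av^2+cw^2+dv+ew)}E_\mu(-iw/b,v)$,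 and the quadratic-phase Dunkl transform of $f\in L^1_\mu(\mathbb{R})$ is $\mathcal{D}^{a,b,c}_{d,e,\mu}[f](w)=\frac{c_\mu}{(ib)^{\mu+1}}\int_{\mathbb{R}}\Psi^{a,b,c}_{d,e,\mu}(w,v)f(v)|v|^{2\mu+1}dv$. The symbols $\Psi^{-c,-b,-a}_{-e,-d,\mu}$ and $\mathcal{D}^{-c,-b,-a}_{-e,-d,\mu}$ denote the same objects with $(a,b,c,d,e)$ replaced by $(-c,-b,-a,-e,-d)$. Complex powers are taken with the principal branch. *)

(* Defs.v *)
From HB Require Import structures.
From mathcomp Require Import all_boot all_order all_algebra.
From mathcomp Require Import all_classical all_reals all_analysis.
From mathcomp Require Export complex.

Set Implicit Arguments.
Unset Strict Implicit.
Unset Printing Implicit Defensive.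

Import Order.TTheory GRing.Theory Num.Theory.
Import numFieldNormedType.Exports.
Import ComplexField.Normc.

Local Open Scope classical_set_scope.
Local Open Scope ring_scope.
Local Open Scope complex_scope.

Section ComplexFunctions.
Variable R : realType.
Implicit Types z w : R[i].

Definition cexp z : R[i] :=
  (expR (complex.Re z))%:C *
  (cos (complex.Im z) +i* sin (complex.Im z)).

(* The principal argument, in ]-pi, pi], for z != 0. *)
Definition carg z : R :=
  if 0 <= complex.Im z then acos (complex.Re z / normc z)
  else - acos (complex.Re z / normc z).

(* The principal branch of the logarithm, for z != 0. *)
Definition clog z : R[i] := ln (normc z) +i* carg z.

(* The value at z = 0 follows the convention of powR. *)
Definition cpow z w : R[i] :=
  if z == 0 then (w == 0)%:R else cexp (w * clog z).

Definition cintegral (g : R -> R[i]) : R[i] :=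
  (\int[lebesgue_measure]_x complex.Re (g x)) +i*
  (\int[lebesgue_measure]_x complex.Im (g x)).

End ComplexFunctions.

Section Dunkl.
Variable R : realType.
Implicit Types (mu a b c d e v w x z : R) (f : R -> R[i]).

(* Euler's integral converges only for x > 0; every argument below is at
   least 1/2 when mu >= -1/2. *)
Definition Gamma x : R :=
  \int[lebesgue_measure]_(t in `]0, +oo[) (t `^ (x - 1) * expR (- t)).

Definition c_ mu : R := (2 `^ (mu + 1) * Gamma (mu + 1))^-1.

(* Representatives are Borel measurable: every Lebesgue measurable function
   agrees almost everywhere with a Borel measurable one, so the classes modulo
   almost everywhere equality are the same. *)
Definition L1_ mu f : Prop :=
  [/\ measurable_fun setT (fun v => complex.Re (f v)),
      measurable_fun setT (fun v => complex.Im (f v)) &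
      (\int[lebesgue_measure]_v (normc (f v) * `|v| `^ (2 * mu + 1))%:E
         < +oo)%E].

Definition bessel_j mu z : R :=
  Gamma (mu + 1) *
  limn (series (fun n : nat =>
    (-1) ^+ n * (z / 2) ^+ (2 * n) / (n`!%:R * Gamma (n%:R + mu + 1)))).

(* dunkl_kernel mu w v is E_mu(iw, v): the factor i of the first argument is
   built in, so that E_mu(-iw/b, v) is dunkl_kernel mu (- w / b) v. *)
Definition dunkl_kernel mu w v : R[i] :=
  (bessel_j mu (w * v))%:C +
  'i%C * (w * v)%:C / (2 * (mu + 1))%:C * (bessel_j (mu + 1) (w * v))%:C.

Definition qpd_kernel a b c d e mu w v : R[i] :=
  cexp (- 'i%C * (a * v ^+ 2 + c * w ^+ 2 + d * v + e * w)%:C) *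
  dunkl_kernel mu (- w / b) v.

Definition qpd_transform a b c d e mu f w : R[i] :=
  (c_ mu)%:C / cpow ('i%C * b%:C) (mu + 1)%:C *
  cintegral (fun v =>
    qpd_kernel a b c d e mu w v * f v * (`|v| `^ (2 * mu + 1))%:C).

End Dunkl.

(* Main.v *)
Require Import Defs.
From HB Require Import structures.
From mathcomp Require Import all_boot all_order all_algebra.
From mathcomp Require Import all_classical all_reals all_analysis.
From mathcomp Require Import complex.
From mathcomp Require Import measurable_realfun normal_distribution ring lra.

Set Implicit Arguments.
Unset Strict Implicit.
Unset Printing Implicit Defensive.

Import Order.TTheory GRing.Theory Num.Theory.
Import numFieldNormedType.Exports.

Local Open Scope classical_set_scope.
Local Open Scope ring_scope.

(** After removal of the quadratic phases the statement is the inversion theorem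
    for the Dunkl transform on [L^1_mu]: with [k = 1 / b],
    [g = e^(- i (a v^2 + d v)) f] and [G] its transform by the kernel
    [E_mu (- i k w, v)], the function [g] is, up to the constant
    [inversion_cst mu k], the transform of [G] by the conjugate kernel. The
    constants of the two quadratic-phase transforms multiply to the same number,
    because the principal powers of [i b] and [- i b] are conjugate.

    The kernel is [E_mu (i t) = A t + i B t], with [A = j_mu] even and
    [B t = t / (2 (mu + 1)) * j_(mu+1) t] odd. Three facts about it are needed.

    It is bounded: Bessel's equation makes [A^2 + B^2] nonincreasing on [t >= 0]
    as soon as [2 mu + 1 >= 0], so its modulus is at most 1
    ([bessel_pow_energy]). Hence all integrals converge, and Fubini's theorem
    moves a transform from one factor of an integral to the other
    ([transform_multiplication]).

    It transforms Gaussians into Gaussians: integrating the power series of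
    [j_mu] termwise against [|v|^(2 mu + 1) e^(- s v^2)] gives a multiple of
    [e^(- k^2 w^2 / (4 s))] ([Rintegral_bessel_gmoment]). The same holds for
    [v e^(- s v^2)] with the odd part of the kernel, and transforming twice gives
    back the same function up to the inverse of the inversion constant. This uses
    only the moments of the Gaussian, that is Euler's integral, and the
    functional equation of [Gamma].

    Consequently [g] and its double transform have the same integrals against
    all [e^(- s v^2)] and [v e^(- s v^2)], [s > 0], for the measure
    [|v|^(2 mu + 1) dv]. A function is determined almost everywhere by these
    integrals ([gauss_uniqueness]). Indeed polynomials in [u = e^(- s x^2)]
    integrate to 0 against the even part; the polynomials [(1 - u^n)^(2^n)]
    converge to the indicator of [u < 1/2], so the integral over each set
    [|x| > T] vanishes, and the fundamental theorem of calculus applies. The odd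
    part is treated by multiplying by [x].

    The proof is written for the pair of real functions formed by the real and
    imaginary parts of [g] ([dunkl_real_inversion]). *)

(** * Real-valued integrable functions *)

Section RealIntegrable.
Context d (T : measurableType d) (R : realType).
Variables (mu : {measure set T -> \bar R}) (D : set T) (mD : measurable D).
Implicit Types f g : T -> R.

Lemma integrable_RZl c f : mu.-integrable D (EFin \o f) ->
  mu.-integrable D (EFin \o (fun x => c * f x)).
Proof. by move=> h; apply: eq_integrable (integrableZl mD c h). Qed.

Lemma integrable_RD f g : mu.-integrable D (EFin \o f) ->
  mu.-integrable D (EFin \o g) -> mu.-integrable D (EFin \o (fun x => f x + g x)).
Proof. by move=> hf hg; apply: eq_integrable (integrableD mD hf hg). Qed.

Lemma integrable_RB f g : mu.-integrable D (EFin \o f) ->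
  mu.-integrable D (EFin \o g) -> mu.-integrable D (EFin \o (fun x => f x - g x)).
Proof. by move=> hf hg; apply: eq_integrable (integrableB mD hf hg). Qed.

End RealIntegrable.

Lemma negligible_set1 (R : realType) (x : R) :
  (@lebesgue_measure R).-negligible [set x].
Proof. by exists [set x]; split => //; exact: lebesgue_measure_set1. Qed.

Section Reflection.
Variable R : realType.
Notation leb := (@lebesgue_measure R).
Implicit Types f : R -> R.

Let opp : measurableTypeR R -> measurableTypeR R := -%R.

Let mopp : measurable_fun setT opp.
Proof. exact: oppr_measurable. Qed.

Lemma integrable_oppr f : leb.-integrable setT (EFin \o f) ->
  leb.-integrable setT (EFin \o (fun x => f (- x))).
Proof.
move=> /integrableP[mf fy].
have mN : measurable_fun setT (fun x : R => (f (- x))%:E).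
  apply/measurable_EFinP; apply: measurableT_comp; first exact/measurable_EFinP.
  exact: oppr_measurable.
apply/integrableP; split => //.
suff <- : (\int[leb]_x `|(f x)%:E| = \int[leb]_x `|(f (- x)%R)%:E|)%E by [].
have := @ge0_integral_pushforward _ _ _ _ R opp
  mopp leb setT (fun x => `|(f x)%:E|)%E measurableT.
rewrite preimage_setT => <-//.
  by apply: eq_measure_integral => //= A mA _; exact/esym/lebesgue_measureN.
exact: measurableT_comp.
Qed.

Lemma Rintegral_oppr f : leb.-integrable setT (EFin \o f) ->
  \int[leb]_x f (- x) = \int[leb]_x f x.
Proof.
move=> intf; have /integrableP[mf _] := intf.
have := @integral_pushforward _ _ _ _ R opp
  mopp leb setT (EFin \o f) mf.
rewrite preimage_setT => /(_ (integrable_oppr intf) measurableT) h.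
rewrite /Rintegral -[X in _ = fine X](_ : \int[pushforward leb opp]_x (f x)%:E = _)%E.
  by congr fine; exact: esym h.
by apply: eq_measure_integral => //= A mA _; exact: lebesgue_measureN.
Qed.

Lemma Rintegral_odd f : leb.-integrable setT (EFin \o f) ->
  (forall x, f (- x) = - f x) -> \int[leb]_x f x = 0.
Proof.
move=> intf oddf; have := Rintegral_oppr intf.
under eq_Rintegral do rewrite oddf -mulN1r.
rewrite RintegralZl// mulN1r => /eqP.
by rewrite eq_sym -addr_eq0 -mulr2n mulrn_eq0/= => /eqP.
Qed.

End Reflection.

(** * Powers times Gaussians *)

Section PowerGauss.
Variable R : realType.
Notation leb := (@lebesgue_measure R).
Implicit Types p s v x : R.

(** At 0, where the power need not be differentiable, [|y| < e^(1/p)] gives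
    [|y|^p < e]. *)
Lemma continuous_powR_normr p : 0 <= p -> continuous (fun v => `|v| `^ p).
Proof.
rewrite le_eqVlt => /predU1P[<-|p0] v.
  under eq_fun do rewrite powRr0.
  exact: cvg_cst.
have [->|v0] := eqVneq v 0; last first.
  apply: (@continuous_comp _ _ _ (fun v : R => `|v|) (fun y : R => y `^ p)).
    exact: norm_continuous.
  apply: differentiable_continuous; apply/derivable1_diffP.
  by apply: derivable_powR; rewrite in_itv/= andbT normr_gt0.
apply/cvgrPdist_lt => e e0 /=.
rewrite normr0 powR0 ?gt_eqF//.
exists (e `^ p^-1); first by rewrite /= powR_gt0.
move=> y /=; rewrite sub0r normrN => ye.
rewrite sub0r normrN ger0_norm ?powR_ge0//.
have -> : e = (e `^ p^-1) `^ p by rewrite -powRrM mulVf ?gt_eqF// powRr1// ltW.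
by rewrite gt0_ltr_powR// nnegrE// powR_ge0.
Qed.

(** [|v| <= 1 + v^2 <= K e^((s / p) v^2)] for a suitable [K]; raise this to the
    power [p]. *)
Lemma powR_normr_le_gauss p s : 0 <= p -> 0 < s ->
  exists2 C, 0 < C & forall v, `|v| `^ p <= C * expR (s * v ^+ 2).
Proof.
rewrite le_eqVlt => /predU1P[<-|p0] s0.
  exists 1 => // v; rewrite powRr0 mul1r -[leLHS]expR0 ler_expR.
  by rewrite mulr_ge0 ?sqr_ge0// ltW.
pose K := 1 + p / s.
have K0 : 0 < K by rewrite addr_gt0// divr_gt0.
exists (K `^ p) => [|v]; first exact: powR_gt0.
have le1 : `|v| <= K * expR (s / p * v ^+ 2).
  have ? : p / s * (s / p) = 1 by field; rewrite !gt_eqF.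
  have ? : 0 < s / p by rewrite divr_gt0.
  have ? : 0 < p / s by rewrite divr_gt0.
  have h := expR_ge1Dx (s / p * v ^+ 2).
  apply: (@le_trans _ _ (K * (1 + s / p * v ^+ 2))); last first.
    by rewrite ler_pM2l.
  rewrite /K mulrDl mul1r mulrDr mulr1 mulrA.
  have -> : v ^+ 2 = `|v| ^+ 2 by rewrite real_normK// num_real.
  have := sqr_ge0 (`|v| - 1); nra.
apply: le_trans (_ : (K * expR (s / p * v ^+ 2)) `^ p <= _).
  by rewrite ge0_ler_powR ?nnegrE//; [exact: ltW|rewrite mulr_ge0 ?expR_ge0 ?ltW].
rewrite powRM ?expR_ge0 ?(ltW K0)// -expRM.
by have -> : s / p * v ^+ 2 * p = s * v ^+ 2 by field; rewrite gt_eqF.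
Qed.

(** For [p = 2 mu + 1], the Gaussian times the density defining [L^1_mu]. *)
Definition gmoment s p v := `|v| `^ p * expR (- (s * v ^+ 2)).

Lemma gmoment_ge0 s p v : 0 <= gmoment s p v.
Proof. by rewrite mulr_ge0 ?powR_ge0 ?expR_ge0. Qed.

Lemma continuous_gauss s : continuous (fun v => expR (- (s * v ^+ 2))).
Proof.
move=> v; apply: continuous_comp; last exact: continuous_expR.
by apply: cvgN; apply: cvgM; [exact: cvg_cst|exact: exprn_continuous].
Qed.

Lemma continuous_gmoment s p : 0 <= p -> continuous (gmoment s p).
Proof.
move=> p0 v; apply: cvgM; first exact: continuous_powR_normr.
exact: continuous_gauss.
Qed.

Lemma measurable_gmoment s p : 0 <= p -> measurable_fun setT (gmoment s p).
Proof. by move=> p0; apply: continuous_measurable_fun; exact: continuous_gmoment. Qed.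

Lemma integrable_gauss s : 0 < s ->
  leb.-integrable setT (EFin \o (fun v => expR (- (s * v ^+ 2)))).
Proof.
(* The normal law with variance 1 / (2 s) has density proportional to it. *)
move=> s0; pose sg := Num.sqrt (2 * s)^-1.
have sg0 : sg != 0 by rewrite gt_eqF// sqrtr_gt0 invr_gt0 mulr_gt0.
have pk0 : normal_peak sg != 0 by rewrite gt_eqF// normal_peak_gt0.
have h := integrableZl _ (normal_peak sg)^-1 (integrable_normal_pdf 0 sg).
apply: eq_integrable (h _) => //= v _ /=.
rewrite /normal_pdf (negbTE sg0) /normal_fun -EFinM mulKf//.
congr (EFin (expR _)).
rewrite subr0 sqr_sqrtr; last by rewrite invr_ge0 mulr_ge0// ltW.
by rewrite -mulr_natr; field; rewrite gt_eqF.
Qed.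

(** Half of the Gaussian absorbs the power. *)
Lemma integrable_gmoment s p : 0 < s -> 0 <= p ->
  leb.-integrable setT (EFin \o gmoment s p).
Proof.
move=> s0 p0; have s20 : 0 < s / 2 by rewrite divr_gt0.
have [C C0 hC] := powR_normr_le_gauss p0 s20.
have h := integrableZl _ C (integrable_gauss s20).
apply: le_integrable (h _) => //=.
- by apply/measurable_EFinP; exact: measurable_gmoment.
- move=> v _; rewrite lee_fin ger0_norm ?gmoment_ge0//.
  apply: le_trans (ler_norm _); apply: le_trans (ler_wpM2r (expR_ge0 _) (hC v)) _.
  by rewrite -[X in X <= _]mulrA -expRD ler_pM2l// ler_expR; lra.
Qed.

End PowerGauss.

(** * Gaussian moments and the Gamma function *)

Section GammaMoments.
Variable R : realType.
Notation leb := (@lebesgue_measure R).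
Implicit Types p s v x t : R.

Lemma sqrt_cvgy : @Num.sqrt R t @[t --> +oo] --> +oo.
Proof.
apply/cvgryPge => A; near=> t.
apply: le_trans (ler_norm A) _; rewrite -sqrtr_sqr; apply: ler_wsqrtr.
by near: t; apply: nbhs_pinfty_ge; exact: num_real.
Unshelve. all: by end_near. Qed.

Lemma bigcup_itvcy_0y (u : R^nat) : (forall n, 0 < u n) -> u @ \oo --> 0 ->
  \bigcup_n `[u n, +oo[%classic = `]0, +oo[%classic.
Proof.
move=> u0 u_0; apply/seteqP; split=> [y [n _]|y]; rewrite /= !in_itv/= !andbT.
  exact: lt_le_trans.
move=> y0; have [n _ hn] : \forall n \near \oo, u n < y by exact: (cvgr_lt 0).
by exists n => //=; rewrite in_itv/= andbT ltW// hn/=.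
Qed.

Lemma ge0_integral_itvcy_cvg (u : R^nat) (f : R -> \bar R) :
  (forall n, 0 < u n) -> u @ \oo --> 0 -> nonincreasing_seq u ->
  measurable_fun `](0:R), +oo[ f -> (forall t, (0 < t)%R -> 0 <= f t)%E ->
  (\int[leb]_(t in `[u n, +oo[) f t)%E @[n --> \oo] -->
  (\int[leb]_(t in `]0%R, +oo[) f t)%E.
Proof.
move=> u0 u_0 nu mf f0; rewrite -(bigcup_itvcy_0y u0 u_0).
apply: ge0_nondecreasing_set_cvg_integral => //.
- move=> m n mn; apply/subsetPset => y /=; rewrite !in_itv/= !andbT.
  by apply: le_trans; exact: nu.
- move=> n; apply: measurable_funS mf => // y /=; rewrite !in_itv/= !andbT.
  exact: lt_le_trans.
- move=> n y /=; rewrite in_itv/= andbT => ny; apply: f0.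
  exact: lt_le_trans ny.
Qed.

Definition Gamma_fun x t := t `^ (x - 1) * expR (- t).

Lemma measurable_Gamma_fun x : measurable_fun `](0:R), +oo[ (EFin \o Gamma_fun x).
Proof.
apply/measurable_EFinP; apply: open_continuous_measurable_fun => //.
move=> t /[!inE] t0; have ct : {for t, continuous (fun y => y `^ (x - 1))}.
  by apply: differentiable_continuous; apply/derivable1_diffP/derivable_powR.
apply: cvgM; first exact: ct.
apply: continuous_comp; last exact: continuous_expR.
exact: continuousN.
Qed.

(** The change of variable [v = sqrt (t / s)]. Its derivative is unbounded near
    [t = 0], so the substitution is made on [[1 / (n + 1), +oo[] and [n] then
    tends to infinity, both integrands being nonnegative. *)
Lemma half_gmoment_Gamma s x : 0 < s -> 1 / 2 <= x ->
  (\int[leb]_(v in `]0%R, +oo[) (gmoment s (2 * x - 1) v)%:E =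
  \int[leb]_(t in `]0%R, +oo[) ((2 * s `^ x)^-1 * Gamma_fun x t)%:E)%E.
Proof.
move=> s0 hx; pose F (t : R) : R := Num.sqrt s^-1 * Num.sqrt t.
have ss0 : 0 < Num.sqrt s^-1 by rewrite sqrtr_gt0 invr_gt0.
have dF t : 0 < t -> is_derive t 1 F (Num.sqrt s^-1 * (2 * Num.sqrt t)^-1).
  move=> t0; have ? := is_derive1_sqrt t0.
  by apply: is_derive_eq.
have F't t : 0 < t -> derive1 F t = Num.sqrt s^-1 * (2 * Num.sqrt t)^-1.
  by move=> t0; have ? := dF _ t0; rewrite derive1E derive_val.
have cF : continuous F.
  by move=> t; apply: cvgM; [exact: cvg_cst|exact: sqrt_continuous].
have cF'0 t : 0 < t -> {for t, continuous (fun t => Num.sqrt s^-1 * (2 * Num.sqrt t)^-1)}.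
  move=> t0; apply: cvgM; first exact: cvg_cst.
  apply: cvgV; first by rewrite mulf_neq0// gt_eqF// sqrtr_gt0.
  by apply: cvgM; [exact: cvg_cst|exact: sqrt_continuous].
have cF' t : 0 < t -> {for t, continuous (derive1 F)}.
  move=> t0; change (derive1 F @ t --> derive1 F t); rewrite F't//.
  apply: cvg_trans (cF'0 _ t0); apply: near_eq_cvg.
  near=> y; rewrite F't//; near: y; exact: lt_nbhsr.
pose a n : R := n.+1%:R^-1.
have a0 n : 0 < a n by rewrite invr_gt0.
have a_0 : a @ \oo --> 0 by exact: cvg_harmonic.
have na : nonincreasing_seq a.
  by move=> m n mn; rewrite lef_pV2 ?posrE// ler_nat ltnS.
pose G := gmoment s (2 * x - 1).
have p0 : 0 <= 2 * x - 1 by lra.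
have cG : continuous G by exact: continuous_gmoment.
have subst n : (\int[leb]_(v in `[F (a n), +oo[) (G v)%:E =
    \int[leb]_(t in `[a n, +oo[) ((2 * s `^ x)^-1 * Gamma_fun x t)%:E)%E.
  rewrite (@increasing_ge0_integration_by_substitutiony R F G (a n)).
  - apply: eq_integral => t; rewrite inE/= in_itv/= andbT => ant; congr EFin.
    have t0 : 0 < t by exact: lt_le_trans ant.
    rewrite !fctE F't// /G /gmoment/Gamma_fun.
    have sV0 : 0 <= s^-1 by rewrite invr_ge0 ltW.
    have F0 : 0 <= F t by rewrite mulr_ge0 ?sqrtr_ge0.
    rewrite ger0_norm//.
    have -> : s * F t ^+ 2 = t.
      rewrite exprMn !sqr_sqrtr// ?(ltW t0)//; field; exact: lt0r_neq0.
    have -> : F t `^ (2 * x - 1) = s `^ (1 / 2 - x) * t `^ (x - 1 / 2).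
      rewrite /F powRM ?sqrtr_ge0// -!powR12_sqrt// ?(ltW t0)// -!powRrM.
      by rewrite -powR_inv1 ?(ltW s0)// -powRrM; congr (_ `^ _ * _ `^ _); field.
    have -> : Num.sqrt s^-1 = s `^ (- (1 / 2)).
      by rewrite -powR12_sqrt// -powR_inv1 ?(ltW s0)// -powRrM; congr powR; field.
    have -> : t `^ (x - 1 / 2) = t `^ (x - 1) * Num.sqrt t.
      rewrite -powR12_sqrt ?(ltW t0)// -powRD; last by apply/implyP => _; exact: lt0r_neq0.
      by congr powR; field.
    have -> : (2 * s `^ x)^-1 = s `^ (1 / 2 - x) * s `^ (- (1 / 2)) / 2.
      rewrite -powRD; last by apply/implyP => _; exact: lt0r_neq0.
      have -> : 1 / 2 - x + - (1 / 2) = - x by field.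
      by rewrite powRN invfM mulrC.
    field; rewrite lt0r_neq0 ?sqrtr_gt0//.
  - move=> y z /[!in_itv]/=; rewrite !andbT => ay az yz.
    by rewrite ltr_pM2l// ltr_sqrt// (le_lt_trans _ yz)// (le_trans _ ay)// ltW.
  - move=> t; rewrite in_itv/= andbT => t0; apply: cF'; exact: lt_trans t0.
  - apply/cvg_ex; exists (derive1 F (a n)); apply: cvg_at_right_filter; exact: cF'.
  - apply/cvg_ex; exists 0.
    apply: (@cvg_trans _ ((Num.sqrt s^-1 * (2 * Num.sqrt t)^-1) @[t --> +oo])).
      apply: near_eq_cvg; near=> y; rewrite F't//; near: y.
    rewrite -[0](mulr0 (Num.sqrt s^-1)); apply: cvgM; first exact: cvg_cst.
    under eq_fun do rewrite invfM.
    rewrite -[0](mulr0 2^-1); apply: cvgM; first exact: cvg_cst.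
    apply/gtr0_cvgV0; last exact: sqrt_cvgy.
    near=> t; rewrite sqrtr_gt0; near: t; apply: nbhs_pinfty_gt; exact: num_real.
  - split; last by apply: cvg_at_right_filter; exact: cF.
    move=> t; rewrite in_itv/= andbT => at0.
    have ? := dF _ (lt_trans (a0 _) at0); exact: ex_derive.
  - apply: gt0_cvgMry => //; exact: sqrt_cvgy.
  - exact: continuous_subspaceT.
  - by move=> *; exact: gmoment_ge0.
have l1 : (\int[leb]_(v in `[F (a n), +oo[) (G v)%:E)%E @[n --> \oo] -->
    (\int[leb]_(v in `]0%R, +oo[) (G v)%:E)%E.
  apply: ge0_integral_itvcy_cvg.
  - by move=> n; rewrite mulr_gt0// sqrtr_gt0.
  - have : F (a n) @[n --> \oo] --> F 0 by apply: cvg_comp a_0 _; exact: cF.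
    by rewrite /F sqrtr0 mulr0.
  - by move=> m n mn; rewrite ler_pM2l// ler_sqrt// ?na// ltW.
  - apply/measurable_EFinP; apply: measurable_funTS; exact: measurable_gmoment.
  - by move=> *; rewrite lee_fin gmoment_ge0.
have l2 : (\int[leb]_(v in `[F (a n), +oo[) (G v)%:E)%E @[n --> \oo] -->
    (\int[leb]_(t in `]0%R, +oo[) ((2 * s `^ x)^-1 * Gamma_fun x t)%:E)%E.
  rewrite (_ : (fun n => _) = (fun n =>
    \int[leb]_(t in `[a n, +oo[) ((2 * s `^ x)^-1 * Gamma_fun x t)%:E)%E); last first.
    by apply/funext => n; exact: subst.
  apply: ge0_integral_itvcy_cvg => //.
  - apply/measurable_EFinP/measurable_funM => //.
    by apply/measurable_EFinP; exact: measurable_Gamma_fun.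
  - move=> t t0; rewrite lee_fin !mulr_ge0 ?invr_ge0 ?expR_ge0 ?powR_ge0//.
    by rewrite mulr_ge0// powR_ge0.
by rewrite -(cvg_lim _ l1)// -(cvg_lim _ l2).
Unshelve. all: by end_near. Qed.

End GammaMoments.

Section GammaFunction.
Variable R : realType.
Notation leb := (@lebesgue_measure R).
Implicit Types p s v x t : R.

Lemma integral_gmoment_half s p : 0 <= p ->
  (\int[leb]_v (gmoment s p v)%:E =
   2%:E * \int[leb]_(v in `]0%R, +oo[) (gmoment s p v)%:E)%E.
Proof.
move=> p0; rewrite ge0_symfun_integralT.
- congr (_ * _)%E; rewrite -set_itvcy integral_itv_obnd_cbnd//.
  apply/measurable_EFinP; apply: measurable_funTS; exact: measurable_gmoment.
- by move=> v; exact: gmoment_ge0.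
- exact: continuous_gmoment.
- by move=> v; rewrite /= /gmoment normrN sqrrN.
Qed.

(** The restriction [1 / 2 <= x] makes the exponent [2 x - 1] nonnegative, so
    that the Gaussian form of Euler's integral has no singularity at 0. *)
Lemma integral_gmoment s x : 0 < s -> 1 / 2 <= x ->
  (\int[leb]_v (gmoment s (2 * x - 1) v)%:E = (Gamma x / s `^ x)%:E)%E.
Proof.
move=> s0 hx; have p0 : 0 <= 2 * x - 1 by lra.
have K0 : 0 < (2 * s `^ x)^-1 by rewrite invr_gt0 mulr_gt0// powR_gt0.
have G0 t : 0 < t -> 0 <= Gamma_fun x t.
  by move=> t0; rewrite mulr_ge0 ?powR_ge0 ?expR_ge0.
have finG : (\int[leb]_(t in `]0%R, +oo[) (Gamma_fun x t)%:E)%E \is a fin_num.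
  have : (\int[leb]_v (gmoment s (2 * x - 1) v)%:E < +oo)%E.
    by apply: integrable_lty => //; exact: integrable_gmoment.
  rewrite integral_gmoment_half// half_gmoment_Gamma//.
  under eq_integral do rewrite EFinM.
  rewrite ge0_integralZl//; first last.
  - by rewrite lee_fin ltW.
  - by move=> t /=; rewrite in_itv/= andbT => t0; rewrite lee_fin G0.
  - exact: measurable_Gamma_fun.
  move=> h; rewrite ge0_fin_numE; last first.
    by apply: integral_ge0 => t /=; rewrite in_itv/= andbT => t0; rewrite lee_fin G0.
  move: h; set I := integral _ _ _; case: I => //= [r _|]; first by rewrite ltry.
  by rewrite gt0_muley ?lte_fin// gt0_muley ?lte_fin.
rewrite integral_gmoment_half// half_gmoment_Gamma//.
under eq_integral do rewrite EFinM.
rewrite ge0_integralZl//; first last.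
- by rewrite lee_fin ltW.
- by move=> t /=; rewrite in_itv/= andbT => t0; rewrite lee_fin G0.
- exact: measurable_Gamma_fun.
rewrite -(fineK finG) -!EFinM; congr EFin.
rewrite -[fine _]/(Gamma x); field.
by rewrite gt_eqF// powR_gt0.
Qed.

Lemma Rintegral_gmoment s x : 0 < s -> 1 / 2 <= x ->
  \int[leb]_v gmoment s (2 * x - 1) v = Gamma x / s `^ x.
Proof. by move=> s0 hx; rewrite /Rintegral integral_gmoment. Qed.

(** On [[1, 2]] the Gaussian form of the integrand is at least [e^(-4)]. *)
Lemma Gamma_gt0 x : 1 / 2 <= x -> 0 < Gamma x.
Proof.
move=> hx; have p0 : 0 <= 2 * x - 1 by lra.
have := integral_gmoment ltr01 hx; rewrite powR1 divr1 => GE.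
rewrite -lte_fin -GE.
apply: (@lt_le_trans _ _ (\int[leb]_(v in `[1%R, 2%R]) (expR (- (2 ^+ 2)))%:E)%E).
  rewrite integral_cst//= lebesgue_measure_itv/= lte_fin ltr1n -EFinB.
  by rewrite -EFinM lte_fin mulr_gt0// ?expR_gt0//; lra.
apply: (@le_trans _ _ (\int[leb]_(v in `[1%R, 2%R]) (gmoment 1 (2 * x - 1) v)%:E)%E).
  apply: ge0_le_integral => //.
  - apply/measurable_EFinP; apply: measurable_funTS; exact: measurable_gmoment.
  - move=> v /=; rewrite in_itv/= => /andP[v1 v2]; rewrite lee_fin.
    rewrite -[leLHS]mul1r ler_pM ?expR_ge0//.
      suff : 1 `^ (2 * x - 1) <= `|v| `^ (2 * x - 1) by rewrite powR1.
      by rewrite ge0_ler_powR ?nnegrE// ger0_norm//; lra.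
    by rewrite ler_expR lerN2 mul1r lerXn2r ?nnegrE//; lra.
apply: ge0_subset_integral => //.
- by apply/measurable_EFinP; exact: measurable_gmoment.
- by move=> v _; rewrite lee_fin gmoment_ge0.
Qed.

Lemma cvg_Rintegral_itv0n (g : R -> R) : (forall v, 0 <= g v) ->
  leb.-integrable setT (EFin \o g) ->
  \int[leb]_(v in `[0, n%:R]) g v @[n --> \oo] --> \int[leb]_(v in `[0, +oo[) g v.
Proof.
move=> g0 ig.
have -> : `[0%R, +oo[%classic = \bigcup_n `[0 : R, n%:R]%classic.
  apply/seteqP; split=> [y|y [n _]]; rewrite /= !in_itv/=.
    rewrite andbT => y0; exists (Num.truncn y).+1 => //=.
    by rewrite in_itv/= y0 ltW// truncnS_gt.
  by move=> /andP[->].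
apply: fine_cvg; rewrite fineK; last first.
  apply: integrable_fin_num => //; first exact: bigcup_measurable.
  by apply: integrableS ig => //; exact: bigcup_measurable.
apply: (@ge0_nondecreasing_set_cvg_integral _ _ R) => //.
- move=> m n mn; apply/subsetPset => y /=; rewrite !in_itv/= => /andP[-> ym].
  by rewrite (le_trans ym)// ler_nat.
- by move=> n; apply: measurable_funTS; exact: measurable_int ig.
- by move=> n y _; rewrite lee_fin.
Qed.

(** Integration by parts in the Gaussian form: the derivative of
    [v^(2x) e^(-v^2)] is [2x v^(2x-1) e^(-v^2) - 2 v^(2x+1) e^(-v^2)], and the
    primitive vanishes at 0 and at infinity. *)
Lemma GammaS x : 1 / 2 <= x -> Gamma (x + 1) = x * Gamma x.
Proof.
move=> hx; have x0 : 0 < x by lra.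
have p0 : 0 <= 2 * x - 1 by lra.
have p1 : 0 <= 2 * (x + 1) - 1 by lra.
pose I p := \int[leb]_(v in `[0, +oo[) gmoment 1 p v.
have half p : 0 <= p -> \int[leb]_v gmoment 1 p v = 2 * I p.
  move=> hp; rewrite /Rintegral integral_gmoment_half//.
  have m : measurable_fun `](0:R), +oo[ (fun v => (gmoment 1 p v)%:E).
    apply/measurable_EFinP; apply: measurable_funTS; exact: measurable_gmoment.
  rewrite integral_itv_obnd_cbnd// fineM//; apply: integrable_fin_num => //.
  by apply: integrableS (integrable_gmoment ltr01 hp).
suff : 2 * x * I (2 * x - 1) - 2 * I (2 * (x + 1) - 1) = 0.
  have := Rintegral_gmoment ltr01 hx; rewrite half// powR1 divr1 => <-.
  have hx1 : 1 / 2 <= x + 1 by lra.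
  have := Rintegral_gmoment ltr01 hx1; rewrite half// powR1 divr1 => <-.
  lra.
pose F v := v `^ (2 * x) * expR (- (v ^+ 2)).
pose f v := 2 * x * gmoment 1 (2 * x - 1) v - 2 * gmoment 1 (2 * (x + 1) - 1) v.
have cf : continuous f.
  move=> v; apply: cvgB; (apply: cvgM; first exact: cvg_cst);
    exact: continuous_gmoment.
have dF v : 0 < v -> is_derive v 1 F (f v).
  move=> v0; have ? := is_derive1_powR (2 * x) v0.
  apply: is_derive_eq; rewrite /f /gmoment ger0_norm ?(ltW v0)// !mul1r.
  have -> : v `^ (2 * (x + 1) - 1) = v `^ (2 * x) * v.
    transitivity (v `^ (2 * x) * v `^ 1); last by rewrite powRr1// ltW.
    by rewrite -powRD ?(gt_eqF v0) ?implybT//; congr powR; ring.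
  rewrite /GRing.scale/=; ring.
have F0 : F 0 = 0 by rewrite /F powR0 ?mul0r//; lra.
have cF : F n%:R @[n --> \oo] --> 0.
  (* F n <= C e^(- n^2 / 2) <= 2 C / (n + 1), since 1 + n^2 / 2 >= (n + 1) / 2. *)
  have [||C C0 hC] := @powR_normr_le_gauss _ (2 * x) (1 / 2); [lra|lra|].
  apply: (@squeeze_cvgr _ _ _ _ (cst 0) (fun n => 2 * C * n.+1%:R^-1)).
  - near=> n; rewrite mulr_ge0 ?powR_ge0 ?expR_ge0//=.
    have n0 : 0 <= n%:R :> R by [].
    have := hC n%:R; rewrite ger0_norm// => h.
    apply: le_trans (ler_wpM2r (expR_ge0 _) h) _.
    rewrite -[leLHS]mulrA -expRD (_ : _ + _ = - (n%:R ^+ 2 / 2)); last by field.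
    rewrite -[leRHS]mulrA mulrCA ler_pM2l// expRN.
    have -> : 2 / n.+1%:R = (n.+1%:R / 2)^-1 :> R by rewrite invf_div.
    rewrite lef_pV2 ?posrE ?expR_gt0 ?divr_gt0//.
    apply: le_trans (expR_ge1Dx _); rewrite -natr1.
    have := sqr_ge0 (n%:R - 1 : R); nra.
  - exact: cvg_cst.
  - rewrite -[0](mulr0 (2 * C)); apply: cvgM; first exact: cvg_cst.
    exact: cvg_harmonic.
have cI : F n%:R @[n --> \oo] --> 2 * x * I (2 * x - 1) - 2 * I (2 * (x + 1) - 1).
  have cJ p c : 0 <= p ->
    c * \int[leb]_(v in `[0, n%:R]) gmoment 1 p v @[n --> \oo] --> c * I p.
    move=> hp; apply: cvgM; first exact: cvg_cst.
    apply: cvg_Rintegral_itv0n; first by move=> v; exact: gmoment_ge0.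
    exact: integrable_gmoment.
  apply: cvg_trans (cvgB (cJ _ (2 * x) p0) (cJ _ 2 p1)).
  apply: near_eq_cvg; near=> n.
  have ig p : 0 <= p -> leb.-integrable `[0, n%:R] (EFin \o gmoment 1 p).
    by move=> hp; apply: integrableS (integrable_gmoment ltr01 hp).
  rewrite !fctE -!RintegralZl//; [|exact: ig..].
  rewrite -RintegralB//; [|exact/integrable_RZl/ig..].
  have n0 : 0 < n%:R :> R by rewrite ltr0n; near: n; exact: nbhs_infty_gt.
  rewrite /Rintegral (@continuous_FTC2 _ f F)// ?F0 ?sube0//.
  - exact: continuous_subspaceT.
  - split.
    + move=> y; rewrite in_itv/= => /andP[y0 _].
      by have ? := dF _ y0; exact: ex_derive.
    + have c0 : gmoment 1 (2 * x) v @[v --> 0^'+] --> gmoment 1 (2 * x) 0.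
        by apply: cvg_at_right_filter; apply: continuous_gmoment; lra.
      have -> : F 0 = gmoment 1 (2 * x) 0 by rewrite /F /gmoment normr0 mul1r.
      apply: cvg_trans c0; apply: near_eq_cvg; near=> v.
      by rewrite /gmoment /F mul1r ger0_norm.
    + apply: cvg_at_left_filter; apply: differentiable_continuous.
      by apply/derivable1_diffP; have ? := dF _ n0; exact: ex_derive.
  - move=> y; rewrite in_itv/= => /andP[y0 _].
    by have ? := dF _ y0; rewrite derive1E derive_val.
by rewrite -(cvg_lim _ cF)// (cvg_lim _ cI).
Unshelve. all: by end_near. Qed.
End GammaFunction.

(** * The Bessel series *)

Section BesselSeries.
Local Opaque Gamma.
Variable R : realType.
Implicit Types (mu y t e : R) (n N : nat).

(** Taylor coefficients of [j_mu] in the variable [y = t^2]. *)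
Definition bessel_coef mu n : R :=
  (-1) ^+ n * Gamma (mu + 1) / (4 ^+ n * n`!%:R * Gamma (n%:R + mu + 1)).

Lemma bessel_coef0 mu : - (1 / 2) <= mu -> bessel_coef mu 0 = 1.
Proof.
move=> hmu; rewrite /bessel_coef !expr0 fact0 !mul1r add0r divff//.
by rewrite gt_eqF// Gamma_gt0//; lra.
Qed.

Lemma bessel_coefS mu n : - (1 / 2) <= mu ->
  bessel_coef mu n.+1 =
  - (bessel_coef mu n / (4 * n.+1%:R * (n%:R + mu + 1))).
Proof.
move=> hmu; rewrite /bessel_coef factS natrM !exprS -[n.+1%:R]natr1.
have n0 : 0 <= n%:R :> R by [].
have -> : n%:R + 1 + mu + 1 = n%:R + mu + 1 + 1 by ring.
rewrite (@GammaS _ (n%:R + mu + 1)); last by lra.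
have : Gamma (n%:R + mu + 1) != 0 by rewrite gt_eqF// Gamma_gt0//; lra.
have : n`!%:R != 0 :> R by rewrite pnatr_eq0 -lt0n fact_gt0.
have : 4 ^+ n != 0 :> R by rewrite expf_neq0 ?pnatr_eq0.
have : n%:R + mu + 1 != 0 by rewrite gt_eqF//; lra.
have : n%:R + 1 != 0 :> R by rewrite gt_eqF//; lra.
move: (n%:R) (Gamma _) (Gamma _) (4 ^+ n) (n`!%:R) ((-1) ^+ n).
move=> m G1 G2 q f u *; field.
by repeat (apply/andP; split) => //; rewrite addrC.
Qed.

Lemma bessel_coef_shift mu n : - (1 / 2) <= mu ->
  bessel_coef (mu + 1) n = (mu + 1) / (n%:R + mu + 1) * bessel_coef mu n.
Proof.
move=> hmu; rewrite /bessel_coef.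
have n0 : 0 <= n%:R :> R by [].
have -> : n%:R + (mu + 1) + 1 = n%:R + mu + 1 + 1 by ring.
rewrite (@GammaS _ (mu + 1)) ?(@GammaS _ (n%:R + mu + 1)); [|lra|lra].
have : Gamma (n%:R + mu + 1) != 0 by rewrite gt_eqF// Gamma_gt0//; lra.
have : n`!%:R != 0 :> R by rewrite pnatr_eq0 -lt0n fact_gt0.
have : 4 ^+ n != 0 :> R by rewrite expf_neq0 ?pnatr_eq0.
have : n%:R + mu + 1 != 0 by rewrite gt_eqF//; lra.
move: (n%:R) (Gamma _) (Gamma _) (4 ^+ n) (n`!%:R) ((-1) ^+ n).
move=> m G1 G2 q f u *; field.
by repeat (apply/andP; split).
Qed.

(** The ratio of consecutive coefficients, even multiplied by [n + 1], tends to
    0: the series is dominated by [M e^(e y)] with [e] as small as desired, hence can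
    be integrated termwise against any Gaussian. *)
Lemma bessel_coef_bound mu e : - (1 / 2) <= mu -> 0 < e ->
  exists2 M, 0 <= M & forall n, `|bessel_coef mu n| <= M * (e ^+ n / n`!%:R).
Proof.
move=> hmu e0; pose b n := `|bessel_coef mu n| * (n`!%:R / e ^+ n).
have b0 n : 0 <= b n by rewrite mulr_ge0// divr_ge0// exprn_ge0// ltW.
have bS n : b n.+1 = b n / (4 * e * (n%:R + mu + 1)).
  have n0 : 0 <= n%:R :> R by [].
  rewrite /b bessel_coefS// normrN normrM normfV.
  rewrite (@ger0_norm _ (4 * _ * _)); last by rewrite mulr_ge0//; lra.
  rewrite factS natrM exprS; field.
  by rewrite expf_neq0 ?(gt_eqF e0)//= !gt_eqF//; lra.
(* From N on, b is nonincreasing; the sum of its first terms bounds it. *)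
pose N := (Num.truncn (e^-1)).+1.
have bN n : (N <= n)%N -> b n.+1 <= b n.
  move=> Nn; rewrite bS ler_piMr// invf_le1.
    have : e^-1 <= n%:R.
      by rewrite (@le_trans _ _ N%:R) ?ler_nat// ltW// truncnS_gt.
    by rewrite -[_^-1]mulr1 ler_pdivrMl//; nra.
  have n0 : 0 <= n%:R :> R by [].
  by rewrite mulr_gt0//; lra.
exists (\sum_(i < N.+1) b i); first by rewrite sumr_ge0.
move=> n; suff bS' : b n <= \sum_(i < N.+1) b i.
  have en0 : 0 < e ^+ n by exact: exprn_gt0.
  have fn0 : 0 < n`!%:R :> R by rewrite ltr0n fact_gt0.
  by rewrite -ler_pdivrMr ?divr_gt0// invf_div.
have [nN|Nn] := leqP n N.
  rewrite (bigD1 (Ordinal (nN : (n < N.+1)%N)))//= lerDl.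
  by rewrite sumr_ge0.
apply: (@le_trans _ _ (b N)); last by rewrite big_ord_recr/= lerDr sumr_ge0.
rewrite -(subnK (ltnW Nn)); elim: (n - N)%N => [//|k ih].
by apply: le_trans ih; rewrite addSn bN// leq_addl.
Qed.

Lemma is_cvg_bessel_series mu y : - (1 / 2) <= mu ->
  cvgn (pseries (bessel_coef mu) y).
Proof.
move=> hmu; have [M M0 hM] := bessel_coef_bound hmu ltr01.
apply: normed_cvg.
apply: (@series_le_cvg _ _ (M *: exp_coeff `|y|)) => [n|n|n|].
- by rewrite /= normr_ge0.
- by rewrite mulr_ge0// exp_coeff_ge0.
- rewrite /= normrM; apply: le_trans (ler_wpM2r (normr_ge0 _) (hM n)) _.
  rewrite expr1n div1r -mulrA; apply: ler_wpM2l => //.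
  by rewrite /exp_coeff/= normrX mulrC.
- exact/is_cvg_seriesZ/is_cvg_series_exp_coeff.
Qed.

(** [j_mu] as a function of [y = t^2]: its differential relations are then
    free of the singular coefficient [1 / t]. *)
Definition bessel_pow mu y : R := limn (pseries (bessel_coef mu) y).

Lemma bessel_jE mu t : - (1 / 2) <= mu -> bessel_j mu t = bessel_pow mu (t ^+ 2).
Proof.
move=> hmu; rewrite /bessel_j /bessel_pow.
have G0 : Gamma (mu + 1) != 0 by rewrite gt_eqF// Gamma_gt0//; lra.
have -> : (fun n => (-1) ^+ n * (t / 2) ^+ (2 * n) /
    (n`!%:R * Gamma (n%:R + mu + 1))) =
    (Gamma (mu + 1))^-1 *: (fun n => bessel_coef mu n * (t ^+ 2) ^+ n).
  apply/funext => n; rewrite fctE /GRing.scale/= /bessel_coef.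
  have n0 : 0 <= n%:R :> R by [].
  have -> : (t / 2) ^+ (2 * n) = (t ^+ 2) ^+ n / 4 ^+ n.
    by rewrite exprM expr_div_n expr_div_n; congr (_ / _ ^+ _); ring.
  have : Gamma (n%:R + mu + 1) != 0 by rewrite gt_eqF// Gamma_gt0//; lra.
  have : n`!%:R != 0 :> R by rewrite pnatr_eq0 -lt0n fact_gt0.
  have : 4 ^+ n != 0 :> R by rewrite expf_neq0 ?pnatr_eq0.
  move: G0; move: (Gamma _) (Gamma _) (4 ^+ n) (n`!%:R) ((-1) ^+ n) ((t ^+ 2) ^+ n).
  move=> G1 G2 q f u m *; field.
  by repeat (apply/andP; split).
by rewrite lim_seriesZ ?mulVKf//; exact: is_cvg_bessel_series.
Qed.

Local Opaque bessel_coef.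

Lemma bessel_coef_diffs mu : - (1 / 2) <= mu ->
  pseries_diffs (bessel_coef mu) =
  (- (4 * (mu + 1))^-1) *: bessel_coef (mu + 1).
Proof.
move=> hmu; apply/funext => n; rewrite /pseries_diffs fctE/=.
have n0 : 0 <= n%:R :> R by [].
rewrite bessel_coef_shift// bessel_coefS// /GRing.scale/=.
move: (bessel_coef mu n) => b; field.
by rewrite !gt_eqF//; lra.
Qed.

Lemma pseriesZ (k : R) (c : R^nat) y : pseries (k *: c) y = k *: pseries c y.
Proof.
rewrite /pseries -seriesZ; congr series; apply/funext => n.
by rewrite !fctE /GRing.scale/= mulrA.
Qed.

Lemma is_derive_bessel_pow mu y : - (1 / 2) <= mu ->
  is_derive y 1 (bessel_pow mu) (- (4 * (mu + 1))^-1 * bessel_pow (mu + 1) y).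
Proof.
move=> hmu; have hmu1 : - (1 / 2) <= mu + 1 by lra.
have hmu2 : - (1 / 2) <= mu + 1 + 1 by lra.
have c1 z : cvgn (pseries (pseries_diffs (bessel_coef mu)) z).
  by rewrite bessel_coef_diffs// pseriesZ; apply: is_cvgZl_tmp; exact: is_cvg_bessel_series.
have c2 z : cvgn (pseries (pseries_diffs (pseries_diffs (bessel_coef mu))) z).
  rewrite [X in pseries (pseries_diffs X)]bessel_coef_diffs//.
  have -> : pseries_diffs ((- (4 * (mu + 1))^-1) *: bessel_coef (mu + 1)) =
      (- (4 * (mu + 1))^-1) *: pseries_diffs (bessel_coef (mu + 1)).
    by apply/funext => n; rewrite /pseries_diffs !fctE /GRing.scale/= mulrCA.
  rewrite pseriesZ bessel_coef_diffs// pseriesZ.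
  by do 2 apply: is_cvgZl_tmp; exact: is_cvg_bessel_series.
have yK : `|y| < `| `|y| + 1 | by rewrite [ltRHS]ger0_norm ?addr_ge0// ltrDl.
have D := pseries_snd_diffs (@is_cvg_bessel_series mu _ hmu) (c1 _) (c2 _) yK.
apply: (is_derive_eq D).
rewrite bessel_coef_diffs// pseriesZ limZl_tmp//.
exact: is_cvg_bessel_series.
Qed.

Lemma continuous_bessel_pow mu : - (1 / 2) <= mu -> continuous (bessel_pow mu).
Proof.
move=> hmu y; apply: differentiable_continuous; apply/derivable1_diffP.
by have ? := is_derive_bessel_pow y hmu; exact: ex_derive.
Qed.

(** Together with the formula for the derivative, this is Bessel's equation as
    a first-order system for [j_mu] and [j_(mu+1)]. *)
Lemma bessel_pow_contiguous mu y : - (1 / 2) <= mu ->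
  bessel_pow mu y = bessel_pow (mu + 1) y -
    y / (4 * (mu + 1) * (mu + 2)) * bessel_pow (mu + 2) y.
Proof.
move=> hmu; have hmu1 : - (1 / 2) <= mu + 1 by lra.
have hmu2 : - (1 / 2) <= mu + 2 by lra.
set K := y / _; have KE : K = y / (4 * (mu + 1) * (mu + 2)) by [].
clearbody K.
have l m : - (1 / 2) <= m -> pseries (bessel_coef m) y n @[n --> \oo] --> bessel_pow m y.
  by move=> hm; exact: is_cvg_bessel_series.
have lS m : - (1 / 2) <= m ->
    pseries (bessel_coef m) y n.+1 @[n --> \oo] --> bessel_pow m y.
  by move=> hm; rewrite cvg_shiftS; exact: l.
rewrite -(cvg_lim _ (lS _ hmu))//; apply/cvg_lim => //.
rewrite (_ : (fun n => _) = fun n => pseries (bessel_coef (mu + 1)) y n.+1 -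
    K * pseries (bessel_coef (mu + 2)) y n); last first.
  apply/funext => n; rewrite /pseries /series/= !big_mkord.
  rewrite !big_ord_recl/= !expr0 !bessel_coef0// -addrA; congr (_ + _).
  rewrite mulr_sumr -sumrB; apply: eq_bigr => i _; rewrite /bump/= add1n.
  have i0 : 0 <= i%:R :> R by [].
  have -> : mu + 2 = mu + 1 + 1 by ring.
  rewrite exprS (@bessel_coef_shift (mu + 1))// !bessel_coefS// bessel_coef_shift//.
  rewrite KE; move: (bessel_coef mu i) (y ^+ i) => b z; field.
  by rewrite !gt_eqF//; lra.
apply: cvgB; first exact: lS.
by apply: cvgM; [exact: cvg_cst|exact: l].
Qed.

Lemma bessel_pow0 mu : - (1 / 2) <= mu -> bessel_pow mu 0 = 1.
Proof.
move=> hmu; apply/cvg_lim => //; rewrite -cvg_shiftS.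
rewrite (_ : (fun n => _) = cst 1); first exact: cvg_cst.
apply/funext => n; rewrite /pseries /series/= big_mkord big_ord_recl/=.
rewrite expr0 bessel_coef0// mulr1 big1 ?addr0// => i _.
by rewrite /bump/= expr0n/= mulr0.
Qed.

Local Opaque bessel_pow.

Lemma is_derive_energy (P Q : R -> R) (dP dQ c z : R) :
  is_derive z 1 P dP -> is_derive z 1 Q dQ ->
  is_derive z 1 (fun x => P x ^+ 2 + x * (c * Q x) ^+ 2)
    (2 * P z * dP + c ^+ 2 * (Q z ^+ 2 + 2 * z * Q z * dQ)).
Proof.
move=> hP hQ; apply: is_derive_eq.
by rewrite /GRing.scale/=; ring.
Qed.

(** The left-hand side is 1 at [y = 0] and, by the two relations above, has
    derivative [- (2 mu + 1) (j_(mu+1) / (2 (mu + 1)))^2]. It is therefore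
    at most 1 as soon as [2 mu + 1 >= 0]. *)
Lemma bessel_pow_energy mu y : - (1 / 2) <= mu -> 0 <= y ->
  bessel_pow mu y ^+ 2 +
    y * ((2 * (mu + 1))^-1 * bessel_pow (mu + 1) y) ^+ 2 <= 1.
Proof.
move=> hmu y0; have hmu1 : - (1 / 2) <= mu + 1 by lra.
pose E z := bessel_pow mu z ^+ 2 +
  z * ((2 * (mu + 1))^-1 * bessel_pow (mu + 1) z) ^+ 2.
have E0 : E 0 = 1 by rewrite /E !bessel_pow0// mul0r addr0 expr1n.
have dE (z : R) : is_derive z (1 : R) E
    (- (2 * mu + 1) * ((2 * (mu + 1))^-1 * bessel_pow (mu + 1) z) ^+ 2).
  have D := is_derive_energy (2 * (mu + 1))^-1 (is_derive_bessel_pow z hmu)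
    (is_derive_bessel_pow z hmu1).
  apply: (is_derive_eq D); rewrite (bessel_pow_contiguous z hmu).
  have -> : mu + 1 + 1 = mu + 2 by ring.
  move: (bessel_pow _ z) (bessel_pow _ z) => P Q; field.
  by rewrite !gt_eqF//; lra.
suff : E y <= E 0 by rewrite E0.
move: dE; move: E {E0} => E dE.
have dE1 z : derivable E z 1 by have D := dE z; exact: ex_derive.
apply: (@ler0_derive1_nincry _ E 0) => //.
- move=> z _; have D := dE z; rewrite derive1E derive_val mulNr oppr_le0.
  by rewrite mulr_ge0 ?sqr_ge0//; lra.
- apply: continuous_subspaceT => z; apply: differentiable_continuous.
  exact/derivable1_diffP.
Qed.

End BesselSeries.

(** * The real and imaginary parts of the Dunkl kernel *)

Section DunklKernelParts.
Variable R : realType.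
Notation leb := (@lebesgue_measure R).
Implicit Types (mu t s v w z k : R).

Definition dunkl_even mu t := bessel_j mu t.
Definition dunkl_odd mu t := t / (2 * (mu + 1)) * bessel_j (mu + 1) t.

Lemma dunkl_kernel_energy mu t : - (1 / 2) <= mu ->
  dunkl_even mu t ^+ 2 + dunkl_odd mu t ^+ 2 <= 1.
Proof.
move=> hmu; have hmu1 : - (1 / 2) <= mu + 1 by lra.
rewrite /dunkl_even /dunkl_odd !bessel_jE//.
have := bessel_pow_energy hmu (sqr_ge0 t).
by rewrite -exprMn mulrA.
Qed.

Lemma dunkl_even_le1 mu t : - (1 / 2) <= mu -> `|dunkl_even mu t| <= 1.
Proof.
move=> hmu; have := dunkl_kernel_energy t hmu => h.
rewrite -(@ler_sqr _ _ 1) ?nnegrE// real_normK ?num_real// expr1n.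
by apply: le_trans h; rewrite lerDl sqr_ge0.
Qed.

Lemma dunkl_odd_le1 mu t : - (1 / 2) <= mu -> `|dunkl_odd mu t| <= 1.
Proof.
move=> hmu; have := dunkl_kernel_energy t hmu => h.
rewrite -(@ler_sqr _ _ 1) ?nnegrE// real_normK ?num_real// expr1n.
by apply: le_trans h; rewrite lerDr sqr_ge0.
Qed.

Lemma dunkl_evenN mu t : - (1 / 2) <= mu -> dunkl_even mu (- t) = dunkl_even mu t.
Proof. by move=> hmu; rewrite /dunkl_even !bessel_jE// sqrrN. Qed.

Lemma dunkl_oddN mu t : - (1 / 2) <= mu -> dunkl_odd mu (- t) = - dunkl_odd mu t.
Proof.
move=> hmu; have hmu1 : - (1 / 2) <= mu + 1 by lra.
by rewrite /dunkl_odd !bessel_jE// sqrrN !mulNr.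
Qed.

Lemma continuous_bessel_j mu : - (1 / 2) <= mu -> continuous (bessel_j mu).
Proof.
move=> hmu t; rewrite (_ : bessel_j mu = bessel_pow mu \o (fun t => t ^+ 2)).
  apply: continuous_comp; first exact: exprn_continuous.
  exact: continuous_bessel_pow.
by apply/funext => x /=; rewrite bessel_jE.
Qed.

Lemma continuous_dunkl_even mu : - (1 / 2) <= mu -> continuous (dunkl_even mu).
Proof. exact: continuous_bessel_j. Qed.

Lemma continuous_dunkl_odd mu : - (1 / 2) <= mu -> continuous (dunkl_odd mu).
Proof.
move=> hmu t; apply: cvgM.
  by apply: cvgM; [exact: cvg_id|exact: cvg_cst].
by apply: continuous_bessel_j; lra.
Qed.

Lemma gmomentX s p v i : 0 <= p ->
  gmoment s p v * (v ^+ 2) ^+ i = gmoment s (p + 2 * i%:R) v.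
Proof.
move=> p0; rewrite /gmoment mulrAC; congr (_ * _).
case: i => [|i]; first by rewrite expr0 mulr1 mulr0 addr0.
have -> : (v ^+ 2) ^+ i.+1 = `|v| `^ (2 * i.+1%:R).
  by rewrite -natrM powR_mulrn// exprM real_normK// num_real.
rewrite -powRD//; apply/implyP => /eqP; have : 0 < i.+1%:R :> R by []; lra.
Qed.

(** Termwise integration. The [n]-th moment contributes [Gamma (n + mu + 1)],
    which cancels the denominator of the [n]-th coefficient and leaves the
    exponential series. *)
Lemma Rintegral_bessel_gmoment mu s z : - (1 / 2) <= mu -> 0 < s ->
  leb.-integrable setT
    (EFin \o (fun v => bessel_j mu (z * v) * gmoment s (2 * mu + 1) v)) /\
  \int[leb]_v (bessel_j mu (z * v) * gmoment s (2 * mu + 1) v) =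
  Gamma (mu + 1) / s `^ (mu + 1) * expR (- (z ^+ 2 / (4 * s))).
Proof.
move=> hmu s0; set p := 2 * mu + 1.
have p0 : 0 <= p by rewrite /p; lra.
pose t n v := bessel_coef mu n * z ^+ (2 * n) * gmoment s (p + 2 * n%:R) v.
pose S n v := series (t ^~ v) n.
have it n : leb.-integrable setT (EFin \o t n).
  by apply: integrable_RZl => //; apply: integrable_gmoment => //; rewrite addr_ge0.
have It n : \int[leb]_v t n v =
    Gamma (mu + 1) / s `^ (mu + 1) * exp_coeff (- (z ^+ 2 / (4 * s))) n.
  rewrite RintegralZl//; last by apply: integrable_gmoment => //; rewrite addr_ge0.
  have n0 : 0 <= n%:R :> R by [].
  have -> : p + 2 * n%:R = 2 * (n%:R + mu + 1) - 1 by rewrite /p; ring.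
  rewrite Rintegral_gmoment//; last by lra.
  have -> : s `^ (n%:R + mu + 1) = s `^ (mu + 1) * s ^+ n.
    by rewrite -powR_mulrn ?(ltW s0)// -powRD ?(gt_eqF s0) ?implybT//; congr powR; ring.
  rewrite /exp_coeff /bessel_coef/= (exprNn (_ / _)) expr_div_n exprM.
  have -> : (4 * s) ^+ n = 4 ^+ n * s ^+ n by rewrite exprMn.
  have : Gamma (n%:R + mu + 1) != 0 by rewrite gt_eqF// Gamma_gt0//; lra.
  have : n`!%:R != 0 :> R by rewrite pnatr_eq0 -lt0n fact_gt0.
  have : 4 ^+ n != 0 :> R by rewrite expf_neq0 ?pnatr_eq0.
  have : s `^ (mu + 1) != 0 by rewrite gt_eqF// powR_gt0.
  have : s ^+ n != 0 by rewrite expf_neq0 ?gt_eqF.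
  move: (Gamma _) (Gamma _) (4 ^+ n) (n`!%:R) ((-1) ^+ n) ((z ^+ 2) ^+ n)
    (s `^ _) (s ^+ n).
  move=> G1 G2 q f u y a b *; field.
  by repeat (apply/andP; split).
have iS n : leb.-integrable setT (EFin \o S n) /\
    \int[leb]_v S n v = Gamma (mu + 1) / s `^ (mu + 1) *
      series (exp_coeff (- (z ^+ 2 / (4 * s)))) n.
  elim: n => [|n [ih1 ih2]].
    rewrite /S /series/= !big_geq// mulr0.
    have -> : (fun v => \sum_(0 <= k < 0) t k v) = cst 0.
      by apply/funext => v; rewrite big_geq.
    split; first exact: integrable0.
    by rewrite Rintegral_cst// mul0r.
  have SE : S n.+1 = fun v => S n v + t n v.
    by apply/funext => v; rewrite /S /series/= big_nat_recr.
  rewrite SE; split; first exact: integrable_RD.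
  by rewrite RintegralD// ih2 It {2}/series/= big_nat_recr//= mulrDr.
pose F v := bessel_j mu (z * v) * gmoment s p v.
have SE n v : S n v = pseries (bessel_coef mu) ((z * v) ^+ 2) n * gmoment s p v.
  rewrite /S /series /pseries/= mulr_suml; apply: eq_bigr => i _.
  have -> : ((z * v) ^+ 2) ^+ i = z ^+ (2 * i) * (v ^+ 2) ^+ i.
    by rewrite exprM -exprMn; congr (_ ^+ _); ring.
  by rewrite /t -gmomentX//; ring.
have cS v : S n v @[n --> \oo] --> F v.
  rewrite /F bessel_jE// (_ : (fun n => _) = fun n =>
    pseries (bessel_coef mu) ((z * v) ^+ 2) n * gmoment s p v); last first.
    by apply/funext => n; exact: SE.
  by apply: cvgM; [exact: is_cvg_bessel_series|exact: cvg_cst].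
(* With this e, the majorant M e^(e z^2 v^2) still leaves a Gaussian. *)
have [e e0 he] : exists2 e, 0 < e & e * z ^+ 2 <= s / 2.
  exists (s / (2 * (z ^+ 2 + 1))).
    by rewrite divr_gt0// mulr_gt0// ltr_wpDl// sqr_ge0.
  have := sqr_ge0 z; set y := z ^+ 2 => y0.
  have -> : s / (2 * (y + 1)) * y = s / 2 * (y / (y + 1)).
    by field; rewrite gt_eqF//; lra.
  rewrite ler_piMr ?divr_ge0 ?(ltW s0)// ler_pdivrMr; lra.
have [M M0 hM] := bessel_coef_bound hmu e0.
have bS n v : `|S n v| <= M * gmoment (s / 2) p v.
  set y := (z * v) ^+ 2; have y0 : 0 <= y by exact: sqr_ge0.
  have ey : 0 <= e * y by rewrite mulr_ge0// ltW.
  rewrite SE -/y normrM (ger0_norm (gmoment_ge0 _ _ _)).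
  apply: (@le_trans _ _ (M * expR (e * y) * gmoment s p v)).
    apply: ler_wpM2r; first exact: gmoment_ge0.
    apply: (@le_trans _ _ (M * series (exp_coeff (e * y)) n)); last first.
      apply: ler_wpM2l => //.
      apply: nondecreasing_cvgn_le; last exact: is_cvg_series_exp_coeff.
      by apply: nondecreasing_series => i _ _; exact: exp_coeff_ge0.
    rewrite /pseries /series/= mulr_sumr.
    apply: le_trans (ler_norm_sum _ _ _) _; apply: ler_sum => i _.
    rewrite normrM (ger0_norm (exprn_ge0 _ y0)).
    apply: le_trans (ler_wpM2r (exprn_ge0 _ y0) (hM i)) _.
    by rewrite /exp_coeff/= (exprMn i e y) le_eqVlt; apply/orP; left; apply/eqP; ring.
  rewrite -[leLHS]mulrA; apply: ler_wpM2l => //.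
  rewrite /gmoment mulrCA; apply: ler_wpM2l; first exact: powR_ge0.
  rewrite -expRD ler_expR /y exprMn.
  have := ler_wpM2r (sqr_ge0 v) he; lra.
have mF : measurable_fun setT (EFin \o F).
  apply/measurable_EFinP/measurable_funM; last exact: measurable_gmoment.
  apply: continuous_measurable_fun => v.
  apply: (@continuous_comp _ _ _ ( *%R z) (bessel_j mu)).
    by apply: cvgM; [exact: cvg_cst|exact: cvg_id].
  exact: continuous_bessel_j.
have [] := @dominated_convergence _ _ R leb setT measurableT
  (fun n v => (S n v)%:E) (EFin \o F) (fun v => (M * gmoment (s / 2) p v)%:E).
- by move=> n; exact: measurable_int (iS n).1.
- exact: mF.
- apply/aeW => v _; apply: cvg_EFin; last exact: cS.
  by near=> n.
- apply: integrable_RZl => //; apply: integrable_gmoment => //.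
  by rewrite divr_gt0.
- by apply/aeW => v n _; rewrite /= lee_fin; exact: bS.
move=> iF _ cI; split; first exact: iF.
have cR : \int[leb]_v S n v @[n --> \oo] --> \int[leb]_v F v.
  apply: fine_cvg; rewrite fineK//; exact: integrable_fin_num.
rewrite -(cvg_lim _ cR)//; apply/cvg_lim => //.
rewrite (_ : (fun n => _) = fun n => Gamma (mu + 1) / s `^ (mu + 1) *
  series (exp_coeff (- (z ^+ 2 / (4 * s)))) n); last first.
  by apply/funext => n; exact: (iS n).2.
by apply: cvgM; [exact: cvg_cst|exact: is_cvg_series_exp_coeff].
Unshelve. all: by end_near. Qed.

End DunklKernelParts.

(** * The multiplication formula *)

Section ScaledTransform.
Variable R : realType.
Notation leb := (@lebesgue_measure R).
Implicit Types (K p q : R -> R) (k w : R).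

(** The density [|v|^(2 mu + 1)] is put into [p], so that everything below is
    about Lebesgue integrable functions. *)
Definition scaled_transform K k p w : R := \int[leb]_v (K (k * w * v) * p v).

Lemma integrable_bddM (h : R -> R) M p : measurable_fun setT h ->
  (forall t, `|h t| <= M) -> leb.-integrable setT (EFin \o p) ->
  leb.-integrable setT (EFin \o (fun v => h v * p v)).
Proof.
move=> mh h1 ip; have /integrableP[mp _] := ip.
apply: le_integrable (integrable_RZl measurableT M ip) => //.
- apply/measurable_EFinP; apply: measurable_funM => //.
  exact/measurable_EFinP.
- move=> v _; rewrite /= lee_fin !normrM ler_wpM2r//.
  exact: le_trans (ler_norm _).
Qed.

Lemma measurable_scaled (K : R -> R) k : continuous K ->
  measurable_fun setT (fun v => K (k * v)).
Proof.
move=> cK; apply: measurableT_comp; first exact: continuous_measurable_fun.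
exact: measurable_funM.
Qed.

Lemma integrable_scaled K k p : continuous K -> (forall t, `|K t| <= 1) ->
  leb.-integrable setT (EFin \o p) ->
  leb.-integrable setT (EFin \o (fun v => K (k * v) * p v)).
Proof.
move=> cK K1; apply: (@integrable_bddM _ 1) => //; exact: measurable_scaled.
Qed.

Lemma scaled_transformN K k p w : continuous K -> (forall t, `|K t| <= 1) ->
  leb.-integrable setT (EFin \o p) ->
  scaled_transform K k (fun v => - p v) w = - scaled_transform K k p w.
Proof.
move=> cK K1 ip; rewrite /scaled_transform -[RHS]mulN1r -RintegralZl//.
  by apply: eq_Rintegral => v _; rewrite mulN1r mulrN.
exact: integrable_scaled.
Qed.

(** Fubini's theorem for the bounded kernel [K (k x y)], symmetric in [x] and
    [y]. *)
Section multiplication_formula.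
Variables (K p q : R -> R) (k : R).
Hypotheses (cK : continuous K) (K1 : forall t, `|K t| <= 1).
Hypotheses (ip : leb.-integrable setT (EFin \o p)).
Hypotheses (iq : leb.-integrable setT (EFin \o q)).

Let f (z : measurableTypeR R * measurableTypeR R) : \bar R := (p z.1 * (K (k * z.1 * z.2) * q z.2))%:E.

Let intf : (leb \x leb)%E.-integrable setT f.
Proof.
have /integrableP[mp _] := ip; have /integrableP[mq _] := iq.
have mf : measurable_fun setT f.
  apply/measurable_EFinP; apply: measurable_funM.
    by apply: measurableT_comp => //; exact/measurable_EFinP.
  apply: measurable_funM.
    apply: measurableT_comp; first exact: continuous_measurable_fun.
    by apply: measurable_funM => //; apply: measurable_funM.
  by apply: measurableT_comp => //; exact/measurable_EFinP.
apply/integrable12ltyP => //.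
apply: (@le_lt_trans _ _ (\int[leb]_x (`|(p x)%:E| * \int[leb]_y `|(q y)%:E|))%E).
  have mpq x : measurable_fun setT (fun y => (f (x, y))).
    exact: measurableT_comp.
  apply: ge0_le_integral => //.
  - by move=> x _; exact: integral_ge0.
  - have maf : measurable_fun setT (abse \o f) by exact: measurableT_comp.
    have h := measurable_fun_fubini_tonelli_F (m2 := leb) _ maf.
    by apply: h => z; exact: abse_ge0.
  - under eq_fun do rewrite muleC.
    by apply: measurable_funeM; exact: measurableT_comp.
  - move=> x _; rewrite -ge0_integralZl//; last exact: measurableT_comp.
    apply: ge0_le_integral => //.
    + exact: measurableT_comp.
    + by apply: measurable_funeM; exact: measurableT_comp.
    + move=> y _; rewrite /f/= -EFinM lee_fin !normrM.
      by rewrite ler_wpM2l// ler_piMl.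
have /integrableP[_ Ip] := ip; have /integrableP[_ Iq] := iq.
rewrite ge0_integralZr//.
- by apply: lte_mul_pinfty => //; [exact: integral_ge0|
    rewrite ge0_fin_numE//; exact: integral_ge0].
- exact: measurableT_comp.
- exact: integral_ge0.
Qed.

Let fubini_FE : fubini_F leb f =
  EFin \o (fun x => p x * scaled_transform K k q x).
Proof.
apply/funext => x; rewrite /fubini_F /f/=.
under eq_integral do rewrite EFinM.
have iKq := integrable_scaled (k * x) cK K1 iq.
rewrite integralZl// EFinM /scaled_transform /Rintegral fineK//.
exact: integrable_fin_num.
Qed.

Lemma integrable_mul_transform :
  leb.-integrable setT (EFin \o (fun x => p x * scaled_transform K k q x)).
Proof. by rewrite -fubini_FE; exact: integrable_fubini_F intf. Qed.

Lemma transform_multiplication :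
  \int[leb]_x (p x * scaled_transform K k q x) =
  \int[leb]_y (q y * scaled_transform K k p y).
Proof.
have := Fubini intf; rewrite -/(fubini_F leb f) => h.
rewrite /Rintegral; congr fine.
transitivity (\int[leb]_x fubini_F leb f x)%E; first by rewrite fubini_FE.
rewrite /fubini_F h; apply: eq_integral => y _.
rewrite /f/= (_ : (fun x => _) = fun x => ((q y)%:E * (K (k * y * x) * p x)%:E)%E).
  have iKp := integrable_scaled (k * y) cK K1 ip.
  rewrite integralZl// EFinM /scaled_transform /Rintegral fineK//.
  exact: integrable_fin_num.
by apply/funext => x; rewrite -EFinM mulrAC; congr EFin; ring.
Qed.

End multiplication_formula.
End ScaledTransform.

(** * Functions whose Gaussian moments vanish *)

Section CutoffPolynomials.
Variable R : realType.
Implicit Types (u y : R) (n N : nat).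

(** On [[0, 1]] these polynomials are between 0 and 1 and converge to the
    indicator of [[0, 1/2[], except at [1/2]. *)
Definition cutoff n : {poly R} := (1 - 'X^n) ^+ (2 ^ n).

Lemma cutoffE n u : (cutoff n).[u] = (1 - u ^+ n) ^+ (2 ^ n).
Proof. by rewrite /cutoff horner_exp !hornerE. Qed.

Lemma cutoff_itv n u : 0 <= u <= 1 -> 0 <= (cutoff n).[u] <= 1.
Proof.
move=> /andP[u0 u1]; rewrite cutoffE.
have un : 0 <= u ^+ n <= 1 by rewrite exprn_ge0//= exprn_ile1.
by rewrite exprn_ge0 ?exprn_ile1//; lra.
Qed.

Lemma bernoulli_ineq y N : 0 <= y <= 1 -> 1 - N%:R * y <= (1 - y) ^+ N.
Proof.
move=> /andP[y0 y1]; elim: N => [|N ih]; first by rewrite mul0r subr0 expr0.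
rewrite exprS -natr1; have N0 : 0 <= N%:R :> R by [].
have : 0 <= (1 - y) * ((1 - y) ^+ N - (1 - N%:R * y)).
  by rewrite mulr_ge0//; lra.
have : 0 <= N%:R * y * y by rewrite !mulr_ge0.
lra.
Qed.

(** Bernoulli's inequality: [1 - (2 u)^n <= (1 - u^n)^(2^n)]. *)
Lemma cvg_cutoff1 u : 0 <= u < 1 / 2 -> (cutoff n).[u] @[n --> \oo] --> (1 : R).
Proof.
move=> /andP[u0 u2].
apply: (@squeeze_cvgr _ _ _ _ (fun n => 1 - (2 * u) ^+ n) (cst 1)).
- near=> n; have u1 : 0 <= u <= 1 by lra.
  have /andP[_ ->] := cutoff_itv n u1; rewrite andbT cutoffE exprMn -natrX.
  by apply: bernoulli_ineq; rewrite exprn_ge0//= exprn_ile1//; lra.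
- rewrite -[X in _ --> X]subr0; apply: cvgB; first exact: cvg_cst.
  by apply: cvg_expr; rewrite ger0_norm; lra.
- exact: cvg_cst.
Unshelve. all: by end_near. Qed.

(** [(1 - u^n)^(2^n) <= e^(- (2 u)^n) <= (2 u)^(-n)]. *)
Lemma cvg_cutoff0 u : 1 / 2 < u <= 1 -> (cutoff n).[u] @[n --> \oo] --> (0 : R).
Proof.
move=> /andP[u2 u1]; have u0 : 0 < u by lra.
apply: (@squeeze_cvgr _ _ _ _ (cst 0) (fun n => ((2 * u)^-1) ^+ n)).
- near=> n; have u01 : 0 <= u <= 1 by lra.
  have /andP[-> _] := cutoff_itv n u01; rewrite /= cutoffE.
  have un1 : u ^+ n <= 1 by rewrite exprn_ile1//; lra.
  apply: (@le_trans _ _ (expR (- u ^+ n) ^+ (2 ^ n))).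
    apply: lerXn2r; rewrite ?nnegrE ?expR_ge0//; first by lra.
    exact: expR_ge1Dx.
  rewrite -expRM_natl natrX mulrN -exprMn exprVn expRN.
  rewrite lef_pV2 ?posrE ?expR_gt0//; last by rewrite exprn_gt0//; lra.
  have := expR_ge1Dx ((2 * u) ^+ n); lra.
- exact: cvg_cst.
- apply: cvg_expr; rewrite ger0_norm; last by rewrite invr_ge0; lra.
  by rewrite invf_lt1; lra.
Unshelve. all: by end_near. Qed.
End CutoffPolynomials.

Section LaplaceUniqueness.
Variable R : realType.
Notation leb := (@lebesgue_measure R).
Variable l : R -> R.
Hypothesis evl : forall x, l (- x) = l x.
Hypothesis il : forall s, 0 < s ->
  leb.-integrable setT (EFin \o (fun x => l x * expR (- (s * x ^+ 2)))).
Hypothesis l0 : forall s, 0 < s -> \int[leb]_x (l x * expR (- (s * x ^+ 2))) = 0.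

(** [P (e^(- s x^2))] is a linear combination of Gaussians. *)
Let pint s (P : {poly R}) t : 0 < s -> 0 < t ->
  leb.-integrable setT (EFin \o (fun x =>
    l x * expR (- (t * x ^+ 2)) * P.[expR (- (s * x ^+ 2))])) /\
  \int[leb]_x (l x * expR (- (t * x ^+ 2)) * P.[expR (- (s * x ^+ 2))]) = 0.
Proof.
move=> s0; elim/poly_ind: P t => [|P c ih] t t0.
  rewrite (_ : (fun x => _) = cst 0); last first.
    by apply/funext => x; rewrite horner0 mulr0.
  split; first exact: integrable0.
  by rewrite Rintegral_cst// mul0r.
have [ih1 ih2] := ih _ (addr_gt0 t0 s0).
rewrite (_ : (fun x => _) = fun x =>
    l x * expR (- ((t + s) * x ^+ 2)) * P.[expR (- (s * x ^+ 2))] +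
    c * (l x * expR (- (t * x ^+ 2)))); last first.
  apply/funext => x; rewrite hornerD hornerM hornerX hornerC mulrDl opprD expRD.
  move: (expR _) (expR _) P.[_] => A B C; ring.
have ic := integrable_RZl measurableT c (il t0).
split; first exact: integrable_RD.
by rewrite RintegralD// ih2 add0r RintegralZl ?l0 ?mulr0//; exact: il.
Qed.

Let m x := l x * expR (- (1 * x ^+ 2)).
Let im : leb.-integrable setT (EFin \o m). Proof. exact: il. Qed.

(** Here [s] is such that [e^(- s T^2) = 1/2], so that the cutoff polynomials in
    [e^(- s x^2)] converge to the indicator of [T < |x|]. *)
Let tails T : 0 < T -> \int[leb]_x (m x * \1_[set x | T < `|x|] x) = 0.
Proof.
move=> T0; pose s := ln 2 / T ^+ 2.
have T20 : 0 < T ^+ 2 by rewrite exprn_gt0.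
have ln20 : 0 < ln 2 :> R by rewrite ln_gt0// ltr1n.
have s0 : 0 < s by rewrite divr_gt0.
have mT : measurable [set x : R | T < `|x|].
  rewrite -[X in measurable X]setTI.
  rewrite (_ : [set x | _] = (fun x : R => `|x|) @^-1` `]T, +oo[%classic).
    by apply: (@normr_measurable R setT).
  by apply/seteqP; split=> x /=; rewrite in_itv/= andbT.
pose u x := expR (- (s * x ^+ 2)).
have half : 1 / 2 = expR (- (s * T ^+ 2)) :> R.
  by rewrite /s divfK ?gt_eqF// expRN lnK ?div1r// posrE.
have u01 x : 0 <= u x <= 1.
  by rewrite expR_ge0 expR_le1 oppr_le0 mulr_ge0 ?sqr_ge0// ltW.
have sqT x : (T < `|x|) = (T ^+ 2 < x ^+ 2).
  by rewrite -(real_normK (num_real x)) ltr_pXn2r// ?nnegrE// ltW.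
have sqT' x : (`|x| < T) = (x ^+ 2 < T ^+ 2).
  by rewrite -(real_normK (num_real x)) ltr_pXn2r// ?nnegrE// ltW.
have [] := @dominated_convergence _ _ R leb setT measurableT
  (fun n x => (m x * (cutoff R n).[u x])%:E)
  (fun x => (m x * \1_[set x | T < `|x|] x)%:E) (fun x => `|(m x)%:E|%E).
- by move=> n; exact: measurable_int (pint (cutoff R n) s0 ltr01).1.
- apply/measurable_EFinP; apply: measurable_funM.
    by apply/measurable_EFinP; exact: measurable_int im.
  exact: measurable_indic.
- apply: negligibleS (negligibleU (negligible_set1 T) (negligible_set1 (- T))).
  move=> x /= h.
  apply: contrapT => /not_orP[xT xNT]; apply: h => _.
  apply: cvg_EFin; first by near=> n.
  apply: cvgM; first exact: cvg_cst.
  rewrite indicE; have [Tx|] := ltP T `|x|.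
    rewrite mem_set//; apply: cvg_cutoff1; have /andP[-> _] := u01 x.
    by rewrite half ltr_expR ltrN2 ltr_pM2l// -sqT.
  rewrite le_eqVlt => /predU1P[xT'|xT'].
    by exfalso; move: xT'; have [?|?] := ger0P x; lra.
  rewrite memNset/=; last by apply/negP; rewrite -leNgt ltW.
  apply: cvg_cutoff0; have /andP[_ ->] := u01 x; rewrite andbT.
  by rewrite half ltr_expR ltrN2 ltr_pM2l// -sqT'.
- exact: integrable_abse.
- apply/aeW => x n _ /=; rewrite lee_fin normrM ler_piMr//.
  by have /andP[c0 c1] := cutoff_itv n (u01 x); rewrite ger0_norm.
move=> i1 _ cI.
have cR : \int[leb]_x (m x * (cutoff R n).[u x]) @[n --> \oo] -->
    \int[leb]_x (m x * \1_[set x | T < `|x|] x).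
  by apply: fine_cvg; rewrite fineK//; exact: integrable_fin_num.
rewrite -(cvg_lim _ cR)//; apply/cvg_lim => //.
rewrite (_ : (fun n => _) = cst 0); first exact: cvg_cst.
by apply/funext => n; have [_ ->] := pint (cutoff R n) s0 ltr01.
Unshelve. all: by end_near. Qed.

Let imD (D : set R) : measurable D -> leb.-integrable D (EFin \o m).
Proof. by move=> mD; apply: integrableS im. Qed.

Let left_right T : \int[leb]_(x in `]-oo, (- T)[) m x = \int[leb]_(x in `]T, +oo[) m x.
Proof.
rewrite [LHS]Rintegral_mkcond [RHS]Rintegral_mkcond -[RHS]Rintegral_oppr.
  apply: eq_Rintegral => x _; rewrite !patchE.
  rewrite (_ : (x \in _) = (- x \in `]T, +oo[%classic)); last first.
    by apply/idP/idP; rewrite !inE/= !in_itv/= !andbT ltrNr.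
  by rewrite /m sqrrN evl.
rewrite -restrict_EFin; apply/(integrable_mkcond _ _).1 => //.
exact: imD.
Qed.

Let right_tail T : 0 < T -> \int[leb]_(x in `]T, +oo[) m x = 0.
Proof.
move=> T0; have := tails T0.
have -> : [set x | T < `|x|] = `]-oo, (- T)[%classic `|` `]T, +oo[%classic.
  apply/seteqP; split=> x /=; rewrite !in_itv/= !andbT.
    by rewrite lter_normr orbC ltrNr => /orP.
  by rewrite lter_normr orbC ltrNr => /orP.
under eq_Rintegral do rewrite -[_ * _]/((m \* \1__) _) -patch_indic.
rewrite -Rintegral_mkcond Rintegral_setU//; last 2 first.
- by apply: imD; exact: measurableU.
- apply/disj_setPS => x [/=]; rewrite !in_itv/= andbT => xT Tx; lra.
rewrite left_right -mulr2n => /eqP; rewrite mulrn_eq0/= => /eqP ->//.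
Qed.

Let primitive0 x : x != 0 -> \int[leb]_(t in `]-oo, x]) m t = 0.
Proof.
move=> x0; have [xneg|xpos|] := ltgtP x 0; last by move/eqP; rewrite (negbTE x0).
  rewrite -Rintegral_itv_bndo_bndc; last exact: imD.
  by rewrite -[x]opprK left_right right_tail// oppr_gt0.
have h := @Rintegral_itvB _ m -oo%O +oo%O x (imD (measurable_itv _)) isT isT.
move/eqP: h; rewrite right_tail// subr_eq0 set_itvNyy => /eqP <-.
exact: l0 ltr01.
Qed.

(** The primitive of [l x * e^(- x^2)] vanishes away from 0, and its derivative is
    this function almost everywhere. *)
Lemma gauss_laplace_uniqueness : {ae leb, forall x, l x = 0}.
Proof.
have loc : locally_integrable [set: R] m.
  by have := integrable_locally measurableT im; rewrite patch_setT.
have N0 : {ae leb, forall x : R, x != 0}.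
  apply: (@negligibleS _ _ _ leb [set 0 : R]) => [x /= /negP|].
    by rewrite negbK => /eqP.
  exact: negligible_set1.
have FTC := FTC1Ny (fun y => imD (measurable_itv `]-oo, y])) loc.
apply: negligibleS (negligibleU FTC N0) => x /= lx.
apply: contrapT => /not_orP[/contrapT[_ Fx] /contrapT x0]; apply: lx.
suff mx0 : m x = 0.
  by move/eqP: mx0; rewrite mulf_eq0 expR_eq0 orbF => /eqP.
rewrite -Fx derive1E (@near_eq_derive _ _ _ _ (cst 0)) ?derive_cst//.
near=> y; apply: primitive0; near: y.
exact: open_nbhs_nbhs.
Unshelve. all: by end_near. Qed.

End LaplaceUniqueness.

Section GaussUniqueness.
Variable R : realType.
Notation leb := (@lebesgue_measure R).
Implicit Types (f h : R -> R).

Lemma gauss_even_part0 f :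
  (forall s, 0 < s ->
    leb.-integrable setT (EFin \o (fun x => f x * expR (- (s * x ^+ 2))))) ->
  (forall s, 0 < s -> \int[leb]_x (f x * expR (- (s * x ^+ 2))) = 0) ->
  {ae leb, forall x, f x + f (- x) = 0}.
Proof.
move=> intf f0.
have E s : (fun x => (f x + f (- x)) * expR (- (s * x ^+ 2))) = fun x =>
    f x * expR (- (s * x ^+ 2)) + f (- x) * expR (- (s * (- x) ^+ 2)).
  by apply/funext => x; rewrite sqrrN mulrDl.
apply: gauss_laplace_uniqueness => [x|s s0|s s0].
- by rewrite opprK addrC.
- rewrite E; apply: integrable_RD => //; first exact: intf.
  exact: (@integrable_oppr _ (fun x => f x * expR (- (s * x ^+ 2))) (intf _ s0)).
- rewrite E RintegralD//; last 2 first.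
  + exact: intf.
  + exact: (@integrable_oppr _ (fun x => f x * expR (- (s * x ^+ 2))) (intf _ s0)).
  rewrite (@Rintegral_oppr _ (fun x => f x * expR (- (s * x ^+ 2))) (intf _ s0)).
  by rewrite f0// addr0.
Qed.

(** The even parts of [h] and of [x h x] both vanish, and they determine [h x]
    for [x != 0]. *)
Lemma gauss_uniqueness h :
  (forall s, 0 < s ->
    leb.-integrable setT (EFin \o (fun x => h x * expR (- (s * x ^+ 2))))) ->
  (forall s, 0 < s ->
    leb.-integrable setT (EFin \o (fun x => x * h x * expR (- (s * x ^+ 2))))) ->
  (forall s, 0 < s -> \int[leb]_x (h x * expR (- (s * x ^+ 2))) = 0) ->
  (forall s, 0 < s -> \int[leb]_x (x * h x * expR (- (s * x ^+ 2))) = 0) ->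
  {ae leb, forall x, h x = 0}.
Proof.
move=> i1 i2 z1 z2.
have N := negligibleU (gauss_even_part0 i1 z1) (gauss_even_part0 i2 z2).
apply: negligibleS (negligibleU N (negligible_set1 0)) => x /= hx.
apply: contrapT => /not_orP[/not_orP[/contrapT e1 /contrapT e2] x0]; apply: hx.
have : x * (h x * 2) = 0.
  have -> : h x * 2 = h x - h (- x) by lra.
  rewrite -[RHS]e2; ring.
move/eqP; rewrite !mulf_eq0 pnatr_eq0 orbF => /orP[/eqP//|/eqP//].
Qed.

End GaussUniqueness.

(** * Dunkl transforms of Gaussians *)

Section DunklGauss.
Variable R : realType.
Notation leb := (@lebesgue_measure R).
Variables (mu k : R).
Hypotheses (hmu : - (1 / 2) <= mu) (k0 : k != 0).
Implicit Types (s w v x : R).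

Notation gm s := (gmoment s (2 * mu + 1)).
Notation ogm s := (fun v => v * gmoment s (2 * mu + 1) v).
Notation ET := (scaled_transform (dunkl_even mu) k).
Notation OT := (scaled_transform (dunkl_odd mu) k).

Let p0 : 0 <= 2 * mu + 1. Proof. by move: hmu => h; lra. Qed.

(** The transform of a Gaussian of parameter [s] is one of parameter
    [gauss_dual s]; by [gauss_dualK], transforming twice gives back [s]. *)
Definition gauss_dual s := k ^+ 2 / (4 * s).

Lemma gauss_dual_gt0 s : 0 < s -> 0 < gauss_dual s.
Proof. by move=> s0; rewrite divr_gt0 ?exprn_even_gt0// mulr_gt0. Qed.

Lemma gauss_dualK s : 0 < s -> gauss_dual (gauss_dual s) = s.
Proof. by move=> s0; rewrite /gauss_dual; field; rewrite k0 gt_eqF. Qed.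

Lemma integrable_gm s : 0 < s -> leb.-integrable setT (EFin \o gm s).
Proof. by move=> s0; exact: integrable_gmoment. Qed.

Lemma mul_gmoment s v : v ^+ 2 * gm s v = gmoment s (2 * (mu + 1) + 1) v.
Proof.
rewrite mulrC -[v ^+ 2]expr1 gmomentX//; congr (gmoment _ _ _); ring.
Qed.

Lemma integrable_ogm s : 0 < s -> leb.-integrable setT (EFin \o ogm s).
Proof.
move=> s0; have p1 : 0 <= 2 * (mu + 1) + 1 by move: hmu => h; lra.
apply: le_integrable (integrable_RD measurableT (integrable_gm s0)
  (integrable_gmoment s0 p1)) => //.
- apply/measurable_EFinP/measurable_funM => //; exact: measurable_gmoment.
- move=> v _; rewrite /= lee_fin -mul_gmoment normrM.
  have g0 := gmoment_ge0 s (2 * mu + 1) v.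
  rewrite (ger0_norm g0) (@ger0_norm _ (_ + _)); last first.
    by rewrite addr_ge0// mulr_ge0// sqr_ge0.
  move: g0; move: (gmoment _ _ _) => g g0.
  rewrite (_ : g + v ^+ 2 * g = (1 + v ^+ 2) * g); last by rewrite mulrDl mul1r.
  apply: ler_wpM2r => //.
  rewrite -(real_normK (num_real v)); have := sqr_ge0 (`|v| - 1); nra.
Qed.

Lemma even_transform_gauss s w : 0 < s ->
  ET (gm s) w = Gamma (mu + 1) / s `^ (mu + 1) * expR (- (gauss_dual s * w ^+ 2)).
Proof.
move=> s0; rewrite /scaled_transform /dunkl_even.
have [_ ->] := Rintegral_bessel_gmoment (k * w) hmu s0.
congr (_ * expR (- _)); rewrite /gauss_dual; field; exact: lt0r_neq0.
Qed.

(** The factor [v] of the odd part and the factor [v] of the function raise the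
    index from [mu] to [mu + 1], which reduces the integral to the even case. *)
Lemma odd_transform_gauss s w : 0 < s ->
  OT (ogm s) w = k / 2 * (Gamma (mu + 1) / s `^ (mu + 2)) *
    (w * expR (- (gauss_dual s * w ^+ 2))).
Proof.
move=> s0; rewrite /scaled_transform /dunkl_odd.
have hmu1 : - (1 / 2) <= mu + 1 by move: hmu => h; lra.
have [ib bE] := Rintegral_bessel_gmoment (k * w) hmu1 s0.
rewrite (_ : (fun v => _) = fun v => k * w / (2 * (mu + 1)) *
   (bessel_j (mu + 1) (k * w * v) * gmoment s (2 * (mu + 1) + 1) v)); last first.
  apply/funext => v; rewrite -mul_gmoment; ring.
rewrite RintegralZl// bE GammaS; last by move: hmu => h; lra.
have -> : mu + 1 + 1 = mu + 2 by ring.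
have -> : (k * w) ^+ 2 / (4 * s) = gauss_dual s * w ^+ 2.
  by rewrite /gauss_dual; field; exact: lt0r_neq0.
move: (expR _) => E; field.
by rewrite !gt_eqF ?powR_gt0//; move: hmu => h; lra.
Qed.

Lemma gmomentN s v : gm s (- v) = gm s v.
Proof. by rewrite /gmoment normrN sqrrN. Qed.

Lemma odd_transform_even0 s w : 0 < s -> OT (gm s) w = 0.
Proof.
move=> s0; apply: Rintegral_odd => [|v].
  apply: integrable_scaled (integrable_gm s0).
    exact: continuous_dunkl_odd.
  by move=> t; exact: dunkl_odd_le1.
by rewrite mulrN dunkl_oddN// gmomentN mulNr.
Qed.

Lemma even_transform_odd0 s w : 0 < s -> ET (ogm s) w = 0.
Proof.
move=> s0; apply: Rintegral_odd => [|v].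
  apply: integrable_scaled (integrable_ogm s0).
    exact: continuous_dunkl_even.
  by move=> t; exact: dunkl_even_le1.
by rewrite mulrN dunkl_evenN// gmomentN mulNr mulrN.
Qed.

Definition gauss_even_cst s := Gamma (mu + 1) / s `^ (mu + 1).
Definition gauss_odd_cst s := k / 2 * (Gamma (mu + 1) / s `^ (mu + 2)).
(** The square of [c_mu / |b|^(mu + 1)] for [k = 1 / b]. *)
Definition inversion_cst := (k ^+ 2 / 4) `^ (mu + 1) / Gamma (mu + 1) ^+ 2.

Let G0 : Gamma (mu + 1) != 0.
Proof. by rewrite gt_eqF// Gamma_gt0//; move: hmu => h; lra. Qed.

Let powR_dual s p : 0 < s ->
  s `^ p * gauss_dual s `^ p = (k ^+ 2 / 4) `^ p.
Proof.
move=> s0; rewrite -powRM ?(ltW s0) ?(ltW (gauss_dual_gt0 s0))//.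
congr (_ `^ _); rewrite /gauss_dual; field; exact: lt0r_neq0.
Qed.

Let k24 : 0 < k ^+ 2 / 4.
Proof. by rewrite divr_gt0// exprn_even_gt0. Qed.

(** Transforming an even Gaussian twice multiplies it by the inverse of
    [inversion_cst]. *)
Lemma gauss_even_cst_dual s : 0 < s ->
  inversion_cst * (gauss_even_cst s * gauss_even_cst (gauss_dual s)) = 1.
Proof.
move=> s0; rewrite /inversion_cst /gauss_even_cst -(powR_dual _ s0).
have : s `^ (mu + 1) != 0 by rewrite gt_eqF// powR_gt0.
have : gauss_dual s `^ (mu + 1) != 0.
  by rewrite gt_eqF// powR_gt0// gauss_dual_gt0.
move: G0; move: (Gamma _) (_ `^ _) (_ `^ _) => x y z *; field.
by repeat (apply/andP; split).
Qed.

Lemma gauss_odd_cst_dual s : 0 < s ->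
  inversion_cst * (gauss_odd_cst s * gauss_odd_cst (gauss_dual s)) = 1.
Proof.
move=> s0; rewrite /inversion_cst /gauss_odd_cst.
have -> : (k ^+ 2 / 4) `^ (mu + 1) = (k ^+ 2 / 4) `^ (mu + 2) / (k ^+ 2 / 4).
  have -> : mu + 2 = mu + 1 + 1 by ring.
  rewrite (@powRD _ _ (mu + 1) 1) ?(gt_eqF k24) ?implybT//.
  by rewrite powRr1 ?(ltW k24)// mulfK// gt_eqF.
rewrite -(powR_dual _ s0).
have : s `^ (mu + 2) != 0 by rewrite gt_eqF// powR_gt0.
have : gauss_dual s `^ (mu + 2) != 0.
  by rewrite gt_eqF// powR_gt0// gauss_dual_gt0.
move: G0; move: (Gamma _) (_ `^ _) (_ `^ _) => x y z *; field.
by repeat (apply/andP; split).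
Qed.

(** Moving a transform from [q] onto a Gaussian, where it is known explicitly. *)
Section pairing.
Variables (q : R -> R) (s : R).
Hypotheses (iq : leb.-integrable setT (EFin \o q)) (s0 : 0 < s).

Let cE := continuous_dunkl_even hmu.
Let cO := continuous_dunkl_odd hmu.
Let E1 t := dunkl_even_le1 t hmu.
Let O1 t := dunkl_odd_le1 t hmu.

Let gauss t : 0 < t -> leb.-integrable setT (EFin \o
  (fun w => q w * expR (- (t * w ^+ 2)))).
Proof.
move=> t0; under eq_fun do rewrite mulrC.
apply: (@integrable_bddM _ _ 1) => //.
  by apply: continuous_measurable_fun; exact: continuous_gauss.
move=> w; rewrite ger0_norm ?expR_ge0// expR_le1 oppr_le0.
by rewrite mulr_ge0 ?sqr_ge0// ltW.
Qed.

Let ogauss t : 0 < t -> leb.-integrable setT (EFin \o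
  (fun w => q w * (w * expR (- (t * w ^+ 2))))).
Proof.
move=> t0; under eq_fun do rewrite mulrC.
have [C C0 hC] := powR_normr_le_gauss ler01 t0.
apply: (@integrable_bddM _ _ C) => //.
  apply: measurable_funM => //.
  by apply: continuous_measurable_fun; exact: continuous_gauss.
move=> w; rewrite normrM (ger0_norm (expR_ge0 _)) expRN ler_pdivrMr ?expR_gt0//.
by have := hC w; rewrite powRr1.
Qed.

Lemma integrable_mul_gauss : leb.-integrable setT (EFin \o
  (fun w => q w * expR (- (s * w ^+ 2)))).
Proof. exact: gauss. Qed.

Lemma integrable_mul_ogauss : leb.-integrable setT (EFin \o
  (fun w => q w * (w * expR (- (s * w ^+ 2))))).
Proof. exact: ogauss. Qed.

Lemma integrable_gm_ET : leb.-integrable setT (EFin \o (fun v => gm s v * ET q v)).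
Proof. exact: (integrable_mul_transform k cE E1 (integrable_gm s0) iq). Qed.

Lemma integrable_gm_OT : leb.-integrable setT (EFin \o (fun v => gm s v * OT q v)).
Proof. exact: (integrable_mul_transform k cO O1 (integrable_gm s0) iq). Qed.

Lemma integrable_ogm_ET : leb.-integrable setT (EFin \o (fun v => v * gm s v * ET q v)).
Proof. exact: (integrable_mul_transform k cE E1 (integrable_ogm s0) iq). Qed.

Lemma integrable_ogm_OT : leb.-integrable setT (EFin \o (fun v => v * gm s v * OT q v)).
Proof. exact: (integrable_mul_transform k cO O1 (integrable_ogm s0) iq). Qed.

Lemma pair_gm_ET : \int[leb]_v (gm s v * ET q v) =
  gauss_even_cst s * \int[leb]_w (q w * expR (- (gauss_dual s * w ^+ 2))).
Proof.
rewrite (transform_multiplication k cE E1 (integrable_gm s0) iq).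
rewrite -RintegralZl//; last exact: gauss (gauss_dual_gt0 s0).
by apply: eq_Rintegral => w _; rewrite even_transform_gauss// mulrCA.
Qed.

Lemma pair_gm_OT : \int[leb]_v (gm s v * OT q v) = 0.
Proof.
rewrite (transform_multiplication k cO O1 (integrable_gm s0) iq).
under eq_Rintegral do rewrite odd_transform_even0// mulr0.
by rewrite Rintegral_cst// mul0r.
Qed.

Lemma pair_ogm_OT : \int[leb]_v (v * gm s v * OT q v) =
  gauss_odd_cst s * \int[leb]_w (q w * (w * expR (- (gauss_dual s * w ^+ 2)))).
Proof.
rewrite (transform_multiplication k cO O1 (integrable_ogm s0) iq).
rewrite -RintegralZl//; last exact: ogauss (gauss_dual_gt0 s0).
by apply: eq_Rintegral => w _; rewrite odd_transform_gauss// mulrCA.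
Qed.

Lemma pair_ogm_ET : \int[leb]_v (v * gm s v * ET q v) = 0.
Proof.
rewrite (transform_multiplication k cE E1 (integrable_ogm s0) iq).
under eq_Rintegral do rewrite even_transform_odd0// mulr0.
by rewrite Rintegral_cst// mul0r.
Qed.

End pairing.

End DunklGauss.

(** * Inversion for a pair of real functions *)

(** With [E_mu (- i k w, v) = A - i B], the transform of [g1 + i g2] is
    [G1 + i G2], and [r] is the real part of the transform of [G1 + i G2] by the
    conjugate kernel. *)
Section RealInversion.
Variable R : realType.
Notation leb := (@lebesgue_measure R).
Variables (mu k : R) (g1 g2 : R -> R).
Hypotheses (hmu : - (1 / 2) <= mu) (k0 : k != 0).

Notation weighted g := (fun v => g v * `|v| `^ (2 * mu + 1)).
Notation gm s := (gmoment s (2 * mu + 1)).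
Notation ET := (scaled_transform (dunkl_even mu) k).
Notation OT := (scaled_transform (dunkl_odd mu) k).

Hypothesis ig1 : leb.-integrable setT (EFin \o weighted g1).
Hypothesis ig2 : leb.-integrable setT (EFin \o weighted g2).

Let p1 := weighted g1.
Let p2 := weighted g2.
Let G1 w := ET p1 w + OT p2 w.
Let G2 w := ET p2 w - OT p1 w.

Hypothesis iG1 : leb.-integrable setT (EFin \o weighted G1).
Hypothesis iG2 : leb.-integrable setT (EFin \o weighted G2).

Let r v := ET (weighted G1) v - OT (weighted G2) v.
Let kappa := inversion_cst mu k.

Let gmE s v : `|v| `^ (2 * mu + 1) * expR (- (s * v ^+ 2)) = gm s v. Proof. by []. Qed.

Let igr s : 0 < s -> leb.-integrable setT (EFin \o (fun v => gm s v * r v)).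
Proof.
move=> s0; rewrite (_ : (fun v => _) = fun v =>
  gm s v * ET (weighted G1) v - gm s v * OT (weighted G2) v).
  apply: integrable_RB => //; first exact: integrable_gm_ET.
  exact: integrable_gm_OT.
by apply/funext => v; rewrite mulrBr.
Qed.

Let iogr s : 0 < s -> leb.-integrable setT (EFin \o (fun v => v * gm s v * r v)).
Proof.
move=> s0; rewrite (_ : (fun v => _) = fun v =>
  v * gm s v * ET (weighted G1) v - v * gm s v * OT (weighted G2) v).
  apply: integrable_RB => //; first exact: integrable_ogm_ET.
  exact: integrable_ogm_OT.
by apply/funext => v; rewrite mulrBr.
Qed.

(** Both transforms are moved onto the Gaussian in turn; after the second one its
    parameter is again [s]. The terms mixing an even and an odd function vanish. *)
Let even_pairing s : 0 < s ->
  kappa * \int[leb]_v (gm s v * r v) =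
  \int[leb]_v (p1 v * expR (- (s * v ^+ 2))).
Proof.
move=> s0; have s'0 := gauss_dual_gt0 k0 s0.
under eq_Rintegral do rewrite mulrBr.
rewrite RintegralB//; [|exact: integrable_gm_ET|exact: integrable_gm_OT].
rewrite pair_gm_ET// pair_gm_OT// subr0.
have -> : \int[leb]_w (weighted G1 w * expR (- (gauss_dual k s * w ^+ 2))) =
   gauss_even_cst mu (gauss_dual k s) * \int[leb]_v (p1 v * expR (- (s * v ^+ 2))).
  transitivity (\int[leb]_w (gm (gauss_dual k s) w * ET p1 w +
      gm (gauss_dual k s) w * OT p2 w)).
    by apply: eq_Rintegral => w _; rewrite -mulrDr -mulrA gmE mulrC.
  rewrite RintegralD//; [|exact: integrable_gm_ET|exact: integrable_gm_OT].
  by rewrite pair_gm_ET// pair_gm_OT// addr0 gauss_dualK.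
rewrite -[RHS]mul1r -(gauss_even_cst_dual hmu k0 s0) /kappa.
by move: (Rintegral _ _ _) => I; ring.
Qed.

Let odd_pairing s : 0 < s ->
  kappa * \int[leb]_v (v * gm s v * r v) =
  \int[leb]_v (p1 v * (v * expR (- (s * v ^+ 2)))).
Proof.
move=> s0; have s'0 := gauss_dual_gt0 k0 s0.
under eq_Rintegral do rewrite mulrBr.
rewrite RintegralB//; [|exact: integrable_ogm_ET|exact: integrable_ogm_OT].
rewrite pair_ogm_ET// pair_ogm_OT// sub0r.
have -> : \int[leb]_w (weighted G2 w * (w * expR (- (gauss_dual k s * w ^+ 2)))) =
   - (gauss_odd_cst mu k (gauss_dual k s) *
     \int[leb]_v (p1 v * (v * expR (- (s * v ^+ 2))))).
  transitivity (\int[leb]_w (w * gm (gauss_dual k s) w * ET p2 w -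
      w * gm (gauss_dual k s) w * OT p1 w)).
    by apply: eq_Rintegral => w _; rewrite -mulrBr -gmE -/(G2 w); ring.
  rewrite RintegralB//; [|exact: integrable_ogm_ET|exact: integrable_ogm_OT].
  by rewrite pair_ogm_ET// pair_ogm_OT// sub0r gauss_dualK.
rewrite -[RHS]mul1r -(gauss_odd_cst_dual hmu k0 s0) /kappa.
by move: (Rintegral _ _ _) => I; ring.
Qed.

(** By the two pairings, all moments of [(g1 - kappa r) |v|^(2 mu + 1)] against
    [e^(- s v^2)] and [v e^(- s v^2)] vanish. *)
Lemma dunkl_real_inversion : {ae leb, forall v, g1 v = inversion_cst mu k *
  (scaled_transform (dunkl_even mu) k (weighted G1) v -
   scaled_transform (dunkl_odd mu) k (weighted G2) v)}.
Proof.
pose h v := (g1 v - kappa * r v) * `|v| `^ (2 * mu + 1).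
have hE s v : h v * expR (- (s * v ^+ 2)) =
    p1 v * expR (- (s * v ^+ 2)) - kappa * (gm s v * r v).
  by rewrite /h /p1 -gmE; ring.
have ohE s v : v * h v * expR (- (s * v ^+ 2)) =
    p1 v * (v * expR (- (s * v ^+ 2))) - kappa * (v * gm s v * r v).
  by rewrite /h /p1 -gmE; ring.
have ih s : 0 < s -> leb.-integrable setT (EFin \o (fun v => p1 v * expR (- (s * v ^+ 2)))).
  exact: integrable_mul_gauss.
have ioh s : 0 < s -> leb.-integrable setT
    (EFin \o (fun v => p1 v * (v * expR (- (s * v ^+ 2))))).
  exact: integrable_mul_ogauss.
have h0 : {ae leb, forall v, h v = 0}.
  apply: gauss_uniqueness => s s0.
  - under eq_fun do rewrite hE.
    by apply: integrable_RB => //; [exact: ih|exact/integrable_RZl/igr].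
  - under eq_fun do rewrite ohE.
    by apply: integrable_RB => //; [exact: ioh|exact/integrable_RZl/iogr].
  - under eq_Rintegral do rewrite hE.
    rewrite RintegralB//; [|exact: ih|exact/integrable_RZl/igr].
    by rewrite RintegralZl ?even_pairing ?subrr//; exact: igr.
  - under eq_Rintegral do rewrite ohE.
    rewrite RintegralB//; [|exact: ioh|exact/integrable_RZl/iogr].
    by rewrite RintegralZl ?odd_pairing ?subrr//; exact: iogr.
apply: negligibleS (negligibleU h0 (negligible_set1 0)) => v /= hv.
apply: contrapT => /not_orP[/contrapT hv0 /eqP v0]; apply: hv.
have : `|v| `^ (2 * mu + 1) != 0 by rewrite gt_eqF// powR_gt0// normr_gt0.
move/eqP: hv0; rewrite mulf_eq0 subr_eq0 => /orP[/eqP//|/eqP ->].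
by rewrite eqxx.
Qed.

End RealInversion.

Section RealInversionPair.
Variable R : realType.
Notation leb := (@lebesgue_measure R).
Variables (mu k : R) (g1 g2 : R -> R).
Hypotheses (hmu : - (1 / 2) <= mu) (k0 : k != 0).

Notation weighted g := (fun v => g v * `|v| `^ (2 * mu + 1)).
Notation ET := (scaled_transform (dunkl_even mu) k).
Notation OT := (scaled_transform (dunkl_odd mu) k).

Hypothesis ig1 : leb.-integrable setT (EFin \o weighted g1).
Hypothesis ig2 : leb.-integrable setT (EFin \o weighted g2).

Let G1 (w : R) := ET (weighted g1) w + OT (weighted g2) w.
Let G2 (w : R) := ET (weighted g2) w - OT (weighted g1) w.

Hypothesis iG1 : leb.-integrable setT (EFin \o weighted G1).
Hypothesis iG2 : leb.-integrable setT (EFin \o weighted G2).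

(** Multiplying [g1 + i g2] by [- i] replaces the pair [(g1, g2)] by
    [(g2, - g1)], and [(G1, G2)] by [(G2, - G1)]. *)
Lemma dunkl_real_inversion_im : {ae leb, forall v, g2 v = inversion_cst mu k *
  (ET (weighted G2) v + OT (weighted G1) v)}.
Proof.
have wN (g : R -> R) : weighted (fun v => - g v) = fun v => - weighted g v.
  by apply/funext => v; rewrite mulNr.
have wN1 (g : R -> R) : weighted (fun v => - g v) = fun v => -1 * weighted g v.
  by apply/funext => v; rewrite mulN1r mulNr.
have intN (g : R -> R) : leb.-integrable setT (EFin \o weighted g) ->
    leb.-integrable setT (EFin \o weighted (fun v => - g v)).
  by rewrite wN1 => ig; exact: integrable_RZl.
have ETN (g : R -> R) w : leb.-integrable setT (EFin \o weighted g) ->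
    ET (weighted (fun v => - g v)) w = - ET (weighted g) w.
  move=> ig; rewrite wN scaled_transformN//; first exact: continuous_dunkl_even.
  by move=> t; exact: dunkl_even_le1.
have OTN (g : R -> R) w : leb.-integrable setT (EFin \o weighted g) ->
    OT (weighted (fun v => - g v)) w = - OT (weighted g) w.
  move=> ig; rewrite wN scaled_transformN//; first exact: continuous_dunkl_odd.
  by move=> t; exact: dunkl_odd_le1.
have G1E : (fun w => (ET (weighted g2) w + OT (weighted (fun v => - g1 v)) w) *
    `|w| `^ (2 * mu + 1)) = weighted G2.
  by apply/funext => w; rewrite OTN.
have G2E : (fun w => (ET (weighted (fun v => - g1 v)) w - OT (weighted g2) w) *
    `|w| `^ (2 * mu + 1)) = weighted (fun w => - G1 w).
  by apply/funext => w; rewrite ETN// -opprD.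
have := @dunkl_real_inversion R mu k g2 (fun v => - g1 v) hmu k0 ig2 (intN _ ig1).
rewrite G1E G2E => /(_ iG2 (intN _ iG1)); apply: negligibleS => v /= hv hv'.
by apply: hv; rewrite hv' OTN// opprK.
Qed.

End RealInversionPair.

(** * Quadratic phases and complex-valued functions *)

Local Open Scope complex_scope.

Section ComplexTools.
Variable R : realType.
Notation leb := (@lebesgue_measure R).
Notation normc := ComplexField.Normc.normc.
Implicit Types (x y z : R[i]) (t s b p : R).

Lemma Re_mulc x y : complex.Re (x * y) =
  complex.Re x * complex.Re y - complex.Im x * complex.Im y.
Proof. by case: x y => [? ?] [? ?]. Qed.

Lemma Im_mulc x y : complex.Im (x * y) =
  complex.Re x * complex.Im y + complex.Im x * complex.Re y.
Proof. by case: x y => [? ?] [? ?]. Qed.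

Lemma complex_eqP x y : complex.Re x = complex.Re y ->
  complex.Im x = complex.Im y -> x = y.
Proof. by case: x y => [? ?] [? ?] /= -> ->. Qed.

Lemma normr_Re_le x : `|complex.Re x| <= normc x.
Proof.
case: x => a b /=; rewrite -sqrtr_sqr; apply: ler_wsqrtr.
by rewrite lerDl sqr_ge0.
Qed.

Lemma normr_Im_le x : `|complex.Im x| <= normc x.
Proof.
case: x => a b /=; rewrite -sqrtr_sqr; apply: ler_wsqrtr.
by rewrite lerDr sqr_ge0.
Qed.

Lemma normc_ge0 x : 0 <= normc x.
Proof. by case: x => a b /=; exact: sqrtr_ge0. Qed.

Definition cis t : R[i] := cos t +i* sin t.

Lemma cisD s t : cis (s + t) = cis s * cis t.
Proof.
by apply: complex_eqP; rewrite ?Re_mulc ?Im_mulc /= ?cosD ?sinD//; ring.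
Qed.

Lemma cis0 : cis 0 = 1.
Proof. by rewrite /cis cos0 sin0. Qed.

Lemma normc_cis t : normc (cis t) = 1.
Proof. by rewrite /= cos2Dsin2 sqrtr1. Qed.

Lemma cexp_Ni t : cexp (- 'i%C * t%:C) = cis (- t).
Proof.
rewrite /cexp Re_mulc Im_mulc /=.
have -> : - 0 * t - - 1 * 0 = 0 :> R by ring.
have -> : - 0 * 0 + - 1 * t = - t :> R by ring.
by rewrite expR0 mul1r.
Qed.

Lemma cpow_imaginary b p : b != 0 ->
  cpow ('i%C * b%:C) p%:C =
  (`|b| `^ p)%:C * cis (p * (if 0 < b then pi / 2 else - (pi / 2))).
Proof.
move=> b0; set z := 'i%C * b%:C.
have Rz : complex.Re z = 0 by rewrite Re_mulc/= mul0r mulr0 subr0.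
have Iz : complex.Im z = b by rewrite Im_mulc/= mulr0 add0r mul1r.
have Nz : normc z = `|b|.
  by rewrite ComplexField.Normc.normcM/= expr0n expr1n/= add0r addr0 sqrtr1 mul1r sqrtr_sqr.
have z0 : (z == 0) = false.
  by apply/negbTE; rewrite eq_complex Rz Iz eqxx.
rewrite /cpow z0 /clog /carg Rz Iz Nz mul0r acos0.
rewrite /cexp Re_mulc Im_mulc /= mul0r subr0 mul0r addr0 -/(cis _); congr (_%:C * cis (_ * _)).
  by rewrite /powR normr_eq0 (negbTE b0).
by rewrite le_eqVlt eq_sym (negbTE b0).
Qed.

(** The arguments of [i b] and [- i b] are opposite, so that the phases of the two
    principal powers cancel. *)
Lemma cpow_imaginaryN b p : b != 0 ->
  cpow ('i%C * b%:C) p%:C * cpow ('i%C * (- b)%:C) p%:C = ((`|b| `^ p) ^+ 2)%:C.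
Proof.
move=> b0; rewrite !cpow_imaginary ?oppr_eq0// normrN.
rewrite mulrACA -cisD -rmorphM -expr2.
suff -> : p * (if 0 < b then pi / 2 else - (pi / 2)) +
    p * (if 0 < - b then pi / 2 else - (pi / 2)) = 0 by rewrite cis0 mulr1.
rewrite oppr_gt0; have [bn|bp|b00] := ltgtP b 0; [ring|ring|].
by rewrite b00 eqxx in b0.
Qed.

Lemma dunkl_kernelE (mu w v : R) :
  dunkl_kernel mu w v = dunkl_even mu (w * v) +i* dunkl_odd mu (w * v).
Proof.
rewrite [RHS]complexE /= /dunkl_kernel /dunkl_even /dunkl_odd; congr (_ + _).
by rewrite -mulrA -mulrA -fmorphV -!rmorphM/= !mulrA.
Qed.

Definition phase (a d v : R) : R[i] := cis (- (a * v ^+ 2 + d * v)).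

Lemma qpd_kernelE (a b c d e mu w v : R) :
  qpd_kernel a b c d e mu w v = phase c e w * (phase a d v *
   (dunkl_even mu (- w / b * v) +i* dunkl_odd mu (- w / b * v))).
Proof.
rewrite /qpd_kernel cexp_Ni dunkl_kernelE mulrA -cisD; congr (cis _ * _); ring.
Qed.

Lemma phaseNK (a d v : R) : phase (- a) (- d) v * phase a d v = 1.
Proof. by rewrite /phase -cisD -cis0; congr cis; ring. Qed.

Lemma normc_phase (a d v : R) : normc (phase a d v) = 1.
Proof. exact: normc_cis. Qed.

Let continuous_angle (a d : R) : continuous (fun v : R => - (a * v ^+ 2 + d * v)).
Proof.
move=> v; apply: cvgN; apply: cvgD; apply: cvgM; try exact: cvg_cst.
  exact: exprn_continuous.
exact: cvg_id.
Qed.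

Lemma measurable_Re_phase (a d : R) :
  measurable_fun setT (fun v => complex.Re (phase a d v)).
Proof.
apply: continuous_measurable_fun => v.
by apply: continuous_comp; [exact: continuous_angle|exact: continuous_cos].
Qed.

Lemma measurable_Im_phase (a d : R) :
  measurable_fun setT (fun v => complex.Im (phase a d v)).
Proof.
apply: continuous_measurable_fun => v.
by apply: continuous_comp; [exact: continuous_angle|exact: continuous_sin].
Qed.

Section integrable_multiplier.
Variables (mu : R) (z f : R -> R[i]) (M : R).
Hypotheses (hmu : - (1 / 2) <= mu) (hf : L1_ mu f).
Hypotheses (mre : measurable_fun setT (fun v => complex.Re (z v)))
           (mim : measurable_fun setT (fun v => complex.Im (z v))).
Hypothesis zM : forall v, normc (z v) <= M.

Let weight (v : R) := `|v| `^ (2 * mu + 1).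

Let p0 : 0 <= 2 * mu + 1. Proof. by move: hmu => h; lra. Qed.

Let mW : measurable_fun setT weight.
Proof. by apply: continuous_measurable_fun; exact: continuous_powR_normr. Qed.

Let dom : leb.-integrable setT (EFin \o (fun v => M * (normc (f v) * weight v))).
Proof.
have [mf1 mf2 fy] := hf.
apply: integrable_RZl => //; apply/integrableP; split.
  apply/measurable_EFinP; apply: measurable_funM => //.
  rewrite (_ : (fun v => _) = Num.sqrt \o
    (fun v => complex.Re (f v) ^+ 2 + complex.Im (f v) ^+ 2)).
    apply: measurableT_comp.
      apply: continuous_measurable_fun; exact: sqrt_continuous.
    by apply: measurable_funD; exact: measurable_funX.
  by apply/funext => v /=; case: (f v).
under eq_integral do rewrite /= ger0_norm ?mulr_ge0 ?normc_ge0 ?powR_ge0//.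
exact: fy.
Qed.

Let bound (u : R[i] -> R) v : (forall x, `|u x| <= normc x) ->
  `|u (z v * f v) * weight v| <= M * (normc (f v) * weight v).
Proof.
move=> hu; rewrite normrM (ger0_norm (powR_ge0 _ _)) mulrA.
apply: ler_wpM2r; first exact: powR_ge0.
apply: le_trans (hu _) _; rewrite ComplexField.Normc.normcM.
by apply: ler_wpM2r => //; exact: normc_ge0.
Qed.

Lemma integrable_Re_mulc : leb.-integrable setT
  (EFin \o (fun v => complex.Re (z v * f v) * `|v| `^ (2 * mu + 1))).
Proof.
have [mf1 mf2 fy] := hf.
apply: le_integrable dom => //.
  apply/measurable_EFinP; apply: measurable_funM => //.
  under eq_fun do rewrite Re_mulc.
  by apply: measurable_funB; exact: measurable_funM.
move=> v _; rewrite /= lee_fin; apply: le_trans (ler_norm _).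
by apply: bound; exact: normr_Re_le.
Qed.

Lemma integrable_Im_mulc : leb.-integrable setT
  (EFin \o (fun v => complex.Im (z v * f v) * `|v| `^ (2 * mu + 1))).
Proof.
have [mf1 mf2 fy] := hf.
apply: le_integrable dom => //.
  apply/measurable_EFinP; apply: measurable_funM => //.
  under eq_fun do rewrite Im_mulc.
  by apply: measurable_funD; exact: measurable_funM.
move=> v _; rewrite /= lee_fin; apply: le_trans (ler_norm _).
by apply: bound; exact: normr_Im_le.
Qed.

End integrable_multiplier.

Lemma cintegralZl (z : R[i]) (h : R -> R[i]) :
  leb.-integrable setT (EFin \o (fun v => complex.Re (h v))) ->
  leb.-integrable setT (EFin \o (fun v => complex.Im (h v))) ->
  cintegral (fun v => z * h v) = z * cintegral h.
Proof.
move=> i1 i2; rewrite /cintegral; apply: complex_eqP.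
  rewrite Re_mulc /=; under eq_Rintegral do rewrite Re_mulc.
  rewrite RintegralB//; [|exact: integrable_RZl..].
  by rewrite !RintegralZl.
rewrite Im_mulc /=; under eq_Rintegral do rewrite Im_mulc.
rewrite RintegralD//; [|exact: integrable_RZl..].
by rewrite !RintegralZl.
Qed.

End ComplexTools.

Section QuadraticPhase.
Variable R : realType.
Notation leb := (@lebesgue_measure R).
Notation normc := ComplexField.Normc.normc.
Implicit Types (a b c d e k v w : R) (f : R -> R[i]).
Variable mu : R.
Hypothesis hmu : - (1 / 2) <= mu.

Notation weighted g := (fun v : R => g v * `|v| `^ (2 * mu + 1)).
Notation ET := (scaled_transform (dunkl_even mu)).
Notation OT := (scaled_transform (dunkl_odd mu)).

Let cE := continuous_dunkl_even hmu.
Let cO := continuous_dunkl_odd hmu.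
Let E1 t := dunkl_even_le1 t hmu.
Let O1 t := dunkl_odd_le1 t hmu.

Lemma even_transformN k (q : R -> R) w : ET (- k) q w = ET k q w.
Proof. by apply: eq_Rintegral => v _; rewrite !mulNr dunkl_evenN. Qed.

Lemma odd_transformN k (q : R -> R) w : leb.-integrable setT (EFin \o q) ->
  OT (- k) q w = - OT k q w.
Proof.
move=> iq; rewrite /scaled_transform -[RHS]mulN1r -RintegralZl//; last exact: integrable_scaled.
by apply: eq_Rintegral => v _; rewrite !mulNr mul1r dunkl_oddN// mulNr.
Qed.

Definition qpd_cst b : R[i] := (c_ mu)%:C / cpow ('i%C * b%:C) (mu + 1)%:C.

Lemma cintegral_dunkl_kernel k w (q1 q2 : R -> R) (z : R[i]) :
  leb.-integrable setT (EFin \o q1) -> leb.-integrable setT (EFin \o q2) ->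
  cintegral (fun v => z *
    ((dunkl_even mu (k * w * v) +i* dunkl_odd mu (k * w * v)) *
     (q1 v +i* q2 v))) =
  z * ((ET k q1 w - OT k q2 w) +i* (ET k q2 w + OT k q1 w)).
Proof.
move=> iq1 iq2.
have iE q : leb.-integrable setT (EFin \o q) -> leb.-integrable setT
    (EFin \o (fun v => dunkl_even mu (k * w * v) * q v)) by exact: integrable_scaled.
have iO q : leb.-integrable setT (EFin \o q) -> leb.-integrable setT
    (EFin \o (fun v => dunkl_odd mu (k * w * v) * q v)) by exact: integrable_scaled.
rewrite cintegralZl; last 2 first.
- by under eq_fun do rewrite Re_mulc; apply: integrable_RB => //; [exact: iE|exact: iO].
- by under eq_fun do rewrite Im_mulc; apply: integrable_RD => //; [exact: iE|exact: iO].
congr (_ * _); apply: complex_eqP => /=.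
  by rewrite RintegralB//; [exact: iE|exact: iO].
by rewrite RintegralD//; [exact: iE|exact: iO].
Qed.

(** The constant [z] serves for the outer transform: its argument is a complex
    multiple of the pair of real functions produced by the inner one. *)
Lemma qpd_transformE a b c d e f (z : R[i]) (h1 h2 : R -> R) w :
  leb.-integrable setT (EFin \o weighted h1) ->
  leb.-integrable setT (EFin \o weighted h2) ->
  (forall v, phase a d v * f v = z * (h1 v +i* h2 v)) ->
  qpd_transform a b c d e mu f w =
  qpd_cst b * (phase c e w * z *
    ((ET (- b^-1) (weighted h1) w - OT (- b^-1) (weighted h2) w) +i*
     (ET (- b^-1) (weighted h2) w + OT (- b^-1) (weighted h1) w))).
Proof.
move=> i1 i2 hE; rewrite /qpd_transform -/(qpd_cst b); congr (_ * _).
rewrite -cintegral_dunkl_kernel//; congr cintegral; apply/funext => v.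
rewrite qpd_kernelE.
have -> : - w / b * v = - b^-1 * w * v by ring.
have -> : (h1 v * `|v| `^ (2 * mu + 1)) +i* (h2 v * `|v| `^ (2 * mu + 1)) =
    (h1 v +i* h2 v) * (`|v| `^ (2 * mu + 1))%:C.
  by apply: complex_eqP; rewrite ?Re_mulc ?Im_mulc/=; ring.
move: (dunkl_even _ _ +i* _) => K; move: (`|v| `^ _)%:C => W.
transitivity (phase c e w * K * W *
    (phase a d v * f v)); first by ring.
by rewrite hE; ring.
Qed.

Let Gamma0 : Gamma (mu + 1) != 0.
Proof. by rewrite gt_eqF// Gamma_gt0//; move: hmu => h; lra. Qed.

Lemma powR_sqr (x p : R) : 0 <= x -> (x ^+ 2) `^ p = (x `^ p) ^+ 2.
Proof. by move=> x0; rewrite expr2 powRM// expr2. Qed.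

Lemma qpd_cst_mulN b : b != 0 ->
  qpd_cst b * qpd_cst (- b) = (inversion_cst mu b^-1)%:C.
Proof.
move=> b0; rewrite /qpd_cst mulrACA -invfM cpow_imaginaryN// -rmorphM -fmorphV.
rewrite -rmorphM; congr (_%:C).
have nb : 0 < `|b| by rewrite normr_gt0.
rewrite /c_ /inversion_cst.
have -> : b^-1 ^+ 2 / 4 = ((`|b| * 2) ^-1) ^+ 2.
  by rewrite -(real_normK (num_real b^-1)) normfV; field; rewrite gt_eqF.
rewrite powR_sqr ?invr_ge0 ?mulr_ge0// -[(_ * 2)^-1]powR_inv1 ?mulr_ge0//.
rewrite powRAC powR_inv1 ?powR_ge0// powRM//.
have : `|b| `^ (mu + 1) != 0 by rewrite gt_eqF// powR_gt0.
have : 2 `^ (mu + 1) != 0 :> R by rewrite gt_eqF// powR_gt0.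
move: Gamma0; move: (Gamma _) (_ `^ _) (_ `^ _) => x y z *; field.
by repeat (apply/andP; split).
Qed.

Lemma qpd_cst_neq0 b : b != 0 -> qpd_cst b != 0.
Proof.
move=> b0; have : qpd_cst b * qpd_cst (- b) != 0.
  rewrite qpd_cst_mulN// (fmorph_eq0 (real_complex R)).
  rewrite mulf_neq0 ?invr_neq0 ?expf_neq0// gt_eqF// powR_gt0//.
  by rewrite divr_gt0// exprn_even_gt0// invr_neq0.
by rewrite mulf_eq0 negb_or => /andP[].
Qed.

End QuadraticPhase.

Section QuadraticPhaseInversion.
Variable R : realType.
Notation leb := (@lebesgue_measure R).
Notation normc := ComplexField.Normc.normc.
Variables (a b c d e mu : R) (f : R -> R[i]).
Hypotheses (hb : b != 0) (hmu : - (1 / 2) <= mu) (hf : L1_ mu f).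

Notation weighted g := (fun v : R => g v * `|v| `^ (2 * mu + 1)).
Notation ET := (scaled_transform (dunkl_even mu) b^-1).
Notation OT := (scaled_transform (dunkl_odd mu) b^-1).

Let Df := qpd_transform a b c d e mu f.
Hypothesis hDf : L1_ mu Df.

Let g1 (v : R) := complex.Re (phase a d v * f v).
Let g2 (v : R) := complex.Im (phase a d v * f v).
Let G1 (w : R) := ET (weighted g1) w + OT (weighted g2) w.
Let G2 (w : R) := ET (weighted g2) w - OT (weighted g1) w.

Let fE v : phase a d v * f v = g1 v +i* g2 v.
Proof. by rewrite /g1 /g2; case: (phase a d v * f v). Qed.

Let ig1 : leb.-integrable setT (EFin \o weighted g1).
Proof.
apply: (@integrable_Re_mulc _ mu (phase a d) f 1) => //.
- exact: measurable_Re_phase.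
- exact: measurable_Im_phase.
- by move=> v; rewrite normc_phase.
Qed.

Let ig2 : leb.-integrable setT (EFin \o weighted g2).
Proof.
apply: (@integrable_Im_mulc _ mu (phase a d) f 1) => //.
- exact: measurable_Re_phase.
- exact: measurable_Im_phase.
- by move=> v; rewrite normc_phase.
Qed.

Let DfE w : Df w = qpd_cst mu b * (phase c e w * (G1 w +i* G2 w)).
Proof.
rewrite /Df (@qpd_transformE _ mu hmu a b c d e f 1 g1 g2)//; last first.
  by move=> v; rewrite mul1r fE.
rewrite mulr1 !even_transformN// !odd_transformN//; congr (_ * (_ * _)).
by rewrite opprK.
Qed.

Let z (w : R) : R[i] := (qpd_cst mu b)^-1 * phase (- c) (- e) w.

(** The Dunkl transform of [g1 + i g2] differs from the given transform of [f] by
    a factor of constant modulus, hence inherits its integrability. *)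
Let GE w : G1 w +i* G2 w = z w * Df w.
Proof. by rewrite DfE /z mulrACA mulVf ?qpd_cst_neq0// mul1r mulrA phaseNK mul1r. Qed.

Let mRez : measurable_fun setT (fun w => complex.Re (z w)).
Proof.
under eq_fun do rewrite Re_mulc.
by apply: measurable_funB; apply: measurable_funM => //;
  [exact: measurable_Re_phase|exact: measurable_Im_phase].
Qed.

Let mImz : measurable_fun setT (fun w => complex.Im (z w)).
Proof.
under eq_fun do rewrite Im_mulc.
by apply: measurable_funD; apply: measurable_funM => //;
  [exact: measurable_Im_phase|exact: measurable_Re_phase].
Qed.

Let zM w : normc (z w) <= normc (qpd_cst mu b)^-1.
Proof. by rewrite ComplexField.Normc.normcM normc_phase mulr1. Qed.

Let iG1 : leb.-integrable setT (EFin \o weighted G1).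
Proof.
rewrite (_ : G1 = fun w => complex.Re (z w * Df w)).
  exact: (integrable_Re_mulc hmu hDf mRez mImz zM).
by apply/funext => w; rewrite -GE.
Qed.

Let iG2 : leb.-integrable setT (EFin \o weighted G2).
Proof.
rewrite (_ : G2 = fun w => complex.Im (z w * Df w)).
  exact: (integrable_Im_mulc hmu hDf mRez mImz zM).
by apply/funext => w; rewrite -GE.
Qed.

(** The inner phase in [w] is undone by the outer one, which leaves two Dunkl
    transforms with conjugate kernels. *)
Let DDfE v : qpd_transform (- c) (- b) (- a) (- e) (- d) mu Df v =
  phase (- a) (- d) v * ((inversion_cst mu b^-1)%:C *
   ((ET (weighted G1) v - OT (weighted G2) v) +i*
    (ET (weighted G2) v + OT (weighted G1) v))).
Proof.
have hE w : phase (- c) (- e) w * Df w = qpd_cst mu b * (G1 w +i* G2 w).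
  by rewrite DfE mulrCA [phase _ _ _ * (_ * _)]mulrA phaseNK mul1r.
rewrite (qpd_transformE hmu (- b) (- a) (- d) v iG1 iG2 hE).
rewrite invrN opprK -qpd_cst_mulN//.
by move: (qpd_cst _ _) (qpd_cst _ _) (phase _ _ _) (_ +i* _) => x y u t; ring.
Qed.

Lemma qpd_inversion : {ae leb, forall v, f v =
  qpd_transform (- c) (- b) (- a) (- e) (- d) mu Df v}.
Proof.
have k0 : b^-1 != 0 by rewrite invr_neq0.
have inv1 := dunkl_real_inversion hmu k0 ig1 ig2 iG1 iG2.
have inv2 := dunkl_real_inversion_im hmu k0 ig1 ig2 iG1 iG2.
apply: negligibleS (negligibleU inv1 inv2) => v /= fv.
apply: contrapT => /not_orP[/contrapT e1 /contrapT e2]; apply: fv.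
rewrite DDfE.
transitivity (phase (- a) (- d) v * (g1 v +i* g2 v)).
  by rewrite -fE mulrA phaseNK mul1r.
congr (_ * _); rewrite [in LHS]e1 [in LHS]e2.
by apply: complex_eqP; rewrite ?Re_mulc ?Im_mulc/= mul0r ?subr0 ?addr0.
Qed.

End QuadraticPhaseInversion.

Theorem theorem3p6 (R : realType) (a b c d e mu : R) (f : R -> R[i])
    (hb : b != 0) (hmu : - (1 / 2) <= mu)
    (hf : L1_ mu f)
    (hDf : L1_ mu (qpd_transform a b c d e mu f)) :
  {ae lebesgue_measure, forall v : R,
    f v = qpd_transform (- c) (- b) (- a) (- e) (- d) mu
            (qpd_transform a b c d e mu f) v /\
    qpd_transform (- c) (- b) (- a) (- e) (- d) mu
        (qpd_transform a b c d e mu f) v =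
      (c_ mu)%:C / cpow (- 'i%C * b%:C) (mu + 1)%:C *
      cintegral (fun w : R =>
        qpd_kernel (- c) (- b) (- a) (- e) (- d) mu v w *
        qpd_transform a b c d e mu f w * (`|w| `^ (2 * mu + 1))%:C)}.
Proof.
apply: negligibleS (qpd_inversion hb hmu hf hDf) => v /= nv fv; apply: nv.
split; first exact: fv.
rewrite {1}/qpd_transform; congr (_ / cpow _ _ * _).
by rewrite rmorphN mulrN mulNr.
Qed.
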